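(* Let $\mathscr{S}_Q$ be the set of $\operatorname{SL}(2,\mathbb{N})$-saturated Farey fractions of order $Q$. For every $\beta\in[0,1]$ and every $\varepsilon>0$, $$\#\big(\mathscr{S}_Q\cap[0,\beta]\big)=\frac{Q^2}{2\zeta(2)}\log\left(\frac{2(1+\beta)}{2+\beta}\right)+O_\varepsilon\big(Q^{7/4+\varepsilon}\big),\qquad Q\to\infty,$$ where the implied constant depends only on $\varepsilon$.
   Context: $Q$ denotes a positive integer. Let $\mathcal{S}$ be the set of matrices $\begin{pmatrix} a&b\\ c&d\end{pmatrix}\in\operatorname{SL}(2,\mathbb{Z})$ with $a\ge b\ge d\ge 1$ and $a\ge c\ge d$, and let $\mathcal{S}_Q=\{M\in\mathcal{S}:\operatorname{Tr}M\le Q\}$. Define $\Psi:\mathcal{S}\to\mathbb{Q}\cap(0,1]$ by $\Psi\begin{pmatrix} a&b\\ c&d\end{pmatrix}=d/b$. The set of $\operatorname{SL}(2,\mathbb{N})$-saturated Farey fractions of order $Q$ is $\mathscr{S}_Q:=\Psi(\mathcal{S}_Q)$ (a set of rational numbers, without multiplicity). $\zeta$ is the Riemann zeta function. *)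

(* Defs.v *)
From HB Require Import structures.
From mathcomp Require Import all_boot all_order all_algebra finmap.
From mathcomp Require Import all_classical all_reals all_analysis.

Set Implicit Arguments.
Unset Strict Implicit.
Unset Printing Implicit Defensive.
Import Order.TTheory GRing.Theory Num.Theory.
Import numFieldNormedType.Exports.
Local Open Scope classical_set_scope.
Local Open Scope ring_scope.

(* The entries of M = (a b; c d) are a = M 0 0, b = M 0 1, c = M 1 0, d = M 1 1. *)
Definition satS : set 'M[int]_2 :=
  [set M | [/\ \det M = 1,
               M 1 1 <= M 0 1 <= M 0 0,
               M 1 1 <= M 1 0 <= M 0 0 &
               1 <= M 1 1]].

Definition satSQ (Q : nat) : set 'M[int]_2 :=
  [set M | satS M /\ \tr M <= Q%:Z].

(* Only meaningful on satS, where it takes values in (0, 1]. *)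
Definition Psi (M : 'M[int]_2) : rat := (M 1 1)%:Q / (M 0 1)%:Q.

Definition satFarey (Q : nat) : set rat := Psi @` satSQ Q.

(* Finiteness makes the cardinality of fset_set below the true one
   (fset_set is empty on infinite sets). *)
Lemma finite_satSQ (Q : nat) : finite_set (satSQ Q).
Proof.
pose f (N : 'M['I_Q.+1]_2) : 'M[int]_2 := map_mx (fun i : 'I_Q.+1 => (nat_of_ord i)%:Z) N.
apply: (@sub_finite_set _ _ (f @` setT)); last exact/finite_image/finite_finset.
move=> M [[_ /andP[h1 h2] /andP[h3 h4] h5]].
rewrite /mxtrace big_ord_recl big_ord1.
have -> : lift ord0 ord0 = 1 :> 'I_2 by apply/val_inj.
move=> htr.
have h6 : M 0 0 <= Q%:Z.
  by apply: le_trans htr; rewrite lerDl; apply: le_trans h5.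
have d0 : 0 <= M 1 1 by apply: le_trans h5.
have key i j : 0 <= M i j <= Q%:Z.
  have H k : k = 0 \/ k = 1 :> 'I_2.
    by case: k => [[|[|//]]] p; [left|right]; apply/val_inj.
  case: (H i) => ->; case: (H j) => ->; apply/andP; split=> //.
  - by rewrite (le_trans d0) // (le_trans h1).
  - by rewrite (le_trans d0).
  - by rewrite (le_trans h2).
  - by rewrite (le_trans d0).
  - by rewrite (le_trans h4).
  - by rewrite (le_trans h1) // (le_trans h2).
exists (\matrix_(i, j) inord `|M i j|%N) => //.
apply/matrixP => i j; rewrite !mxE.
have /andP[m0 mQ] := key i j.
rewrite inordK; first by rewrite gez0_abs.
by rewrite ltnS -lez_nat gez0_abs.
Qed.

Lemma finite_satFarey (Q : nat) : finite_set (satFarey Q).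
Proof. exact/finite_image/finite_satSQ. Qed.

Definition satFarey_count (R : realType) (Q : nat) (beta : R) : nat :=
  #|` fset_set (satFarey Q `&` [set r : rat | 0 <= (ratr r : R) <= beta])|%fset.

(* The Riemann zeta function at real s > 1, where its Dirichlet series
   \sum_(n >= 1) 1 / n `^ s converges. *)
Definition zeta (R : realType) (s : R) : R := limn (series (riemannR s)).

(* Main.v *)
(** The matrix attached to a fraction x/q in lowest terms (q >= 2) with smallest
trace has a = q + x', where x' in [1, q-1] is the inverse of x modulo q.  Hence
the saturated fractions in [0, beta] are the pairs (q, x) with x <= beta q and
q + x + x' <= Q, and for each q one counts points of the modular hyperbola
x x' = 1 (mod q) in a polygon.

The additive characters modulo q replace this count by its expected value up to
incomplete Kloosterman sums.  Since the Fourier coefficients of a polygon have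
an l^1 norm of size log^2 q (relative to q^2), Kloosterman's elementary bound
q^(3/4 + eps), with a factor gcd(n, q), suffices in place of Weil's: the fourth
moment of K(m, n; q) over all (m, n) counts solutions of
(x + y)(z - x)(y - z) = 0 (mod q), and K(m u, n / u; q) = K(m, n; q) for units u.
Summing over q <= Q gives the error O(Q^(7/4 + eps)).

Because x' has been averaged out, the main term is a sum over coprime pairs of
the function clamp (Q/q - 1 - x/q), homogeneous of degree 0 in (Q, q, x);
Moebius inversion turns it into sum_e mu(e) W(Q/e), where W(t) is a sum over all
pairs.  The inner sum of W is evaluated by the primitive clamp_prim of clamp, and
the remaining sums over q of q clamp_prim(t/q - s), for s = 1 and s = 1 + beta,
equal t^2/2 log((s+1)/s) + O(t). *)
Require Import Defs.
From mathcomp Require Import all_boot all_order all_algebra cyclic finmap.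
From mathcomp Require Import all_classical all_reals all_analysis complex.
From mathcomp Require Import zify ring lra.
Set Implicit Arguments.
Unset Strict Implicit.
Unset Printing Implicit Defensive.
Import Order.TTheory GRing.Theory Num.Theory.
Import numFieldNormedType.Exports.
Local Open Scope ring_scope.

(** * Kloosterman sums *)

Lemma card_preim_leq (T U : finType) (h : T -> U) (B : pred U) (k : nat) :
  (forall y, #|[pred x | h x == y]| <= k)%N ->
  (#|[pred x | B (h x)]| <= k * #|B|)%N.
Proof.
move=> hk; rewrite -[X in (X <= _)%N]sum1_card.
have -> : (\sum_(x in [pred x | B (h x)]) 1 = \sum_(y | B y) \sum_(x | B (h x) && (h x == y)) 1)%N.
  exact: (@partition_big _ _ _ _ _ _ (fun x => B (h x)) h B).
rewrite mulnC -sum_nat_const; apply: leq_sum => y By.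
rewrite (leq_trans _ (hk y)) // -sum1_card; apply/eq_leq/eq_bigl => x.
by rewrite !inE; case: eqP => [->|]; rewrite ?andbT ?andbF.
Qed.

Definition ann (A : finComUnitRingType) (z : A) : nat :=
  #|[pred x : A | z * x == 0]|.

Section Kloosterman.
Variables (A : finComUnitRingType).
Implicit Types (x y z u v w : A).

(** A nonempty fibre is a translate of the annihilator of [a]. *)
Lemma card_affine_preim a c y : (#|[pred x : A | (a * x + c)%R == y]| <= ann a)%N.
Proof.
case: (pickP [pred x : A | (a * x + c)%R == y]) => [x0 /eqP hx0|h0]; last first.
  by rewrite (eq_card0 h0).
rewrite /ann -(fintype.card_image (addIr (- x0))).
apply/fintype.subset_leq_card/fintype.subsetP => z /fintype.imageP [x /eqP hx ->].
by rewrite inE mulrDr mulrN subr_eq0 -(inj_eq (addIr c)) hx hx0.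
Qed.

(** Multiplication by [v] sends the annihilator of [u * v] into that of [u], with fibres of size at
    most [ann v]. *)
Lemma annM u v : (ann (u * v)%R <= ann v * ann u)%N.
Proof.
rewrite {1}/ann (eq_card (B := [pred x | [pred y | u * y == 0] (v * x)])); last first.
  by move=> x; rewrite !inE mulrA.
apply: card_preim_leq => y; apply: leq_trans (card_affine_preim v 0 y).
by apply/eq_leq/eq_card => x; rewrite !inE addr0.
Qed.

(** The quadruples of units that survive when the fourth moment of the Kloosterman sums is expanded
    by orthogonality. *)
Definition kloo_quad : pred ((A * A) * (A * A)) := fun t =>
  [&& (t.1.1 \is a GRing.unit) && (t.1.2 \is a GRing.unit),
      (t.2.1 \is a GRing.unit) && (t.2.2 \is a GRing.unit),
      t.1.1 + t.1.2 == t.2.1 + t.2.2 &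
      t.1.1^-1 + t.1.2^-1 == t.2.1^-1 + t.2.2^-1].

(* x + y = z + w and 1/x + 1/y = 1/z + 1/w give (x + y) (zw - xy) = 0, and
   zw - xy = (z - x) (y - z). *)
Lemma kloo_quad_eq0 x y z w : kloo_quad ((x, y), (z, w)) ->
  (2%:R * x + ((z - x) + (y - z))) * ((z - x) * (y - z)) = 0.
Proof.
case/and4P => /= /andP[ux uy] /andP[uz uw] /eqP hs /eqP hi.
have ew : w = x + y - z by rewrite hs; ring.
have h1 : (x + y) * (z * w) = (z + w) * (x * y).
  have e1 : x + y = (x^-1 + y^-1) * (x * y).
    by rewrite mulrDl mulKr // [x * y]mulrC mulKr // addrC.
  have e2 : z + w = (z^-1 + w^-1) * (z * w).
    by rewrite mulrDl mulKr // [z * w]mulrC mulKr // addrC.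
  by rewrite e1 e2 hi; ring.
have -> : (2%:R * x + ((z - x) + (y - z))) * ((z - x) * (y - z))
   = (x + y) * (z * w) - (z + w) * (x * y) by rewrite -hs ew; ring.
by rewrite h1 subrr.
Qed.

(** In the coordinates v = z - x, w = y - z and x, which determine the quadruple because its last
    entry follows from the sum, the equation puts 2x + v + w in the annihilator of v w. For fixed
    (v, w) this leaves at most [ann 2 * ann v * ann w] values of x. *)
Lemma card_kloo_quad :
  (#|kloo_quad| <= ann (2%:R : A) * (\sum_(u : A) ann u) ^ 2)%N.
Proof.
pose F (t : (A * A) * (A * A)) := ((t.2.1 - t.1.1, t.1.2 - t.2.1), t.1.1).
pose D (vw : A * A) := [pred x : A | (2%:R * x + (vw.1 + vw.2)) * (vw.1 * vw.2) == 0].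
have injF : {in kloo_quad &, injective F}.
  move=> [[x y] [z w]] [[x' y'] [z' w']].
  case/and4P => /= _ _ /eqP hs _; case/and4P => /= _ _ /eqP hs' _ [h1 h2 h3].
  subst x'; have hz := addIr _ h1; subst z'; have hy := addIr _ h2; subst y'.
  by move: hs'; rewrite hs => /addrI ->.
have -> : #|kloo_quad| = #|[seq F t | t in kloo_quad]| by rewrite fintype.card_in_image.
apply: (@leq_trans (\sum_(vw : A * A) #|D vw|)%N).
  have -> : (\sum_(vw : A * A) #|D vw| = #|[pred t : (A * A) * A | D t.1 t.2]|)%N.
    rewrite -[RHS]sum1_card -(@pair_big_dep _ _ _ _ _ predT (fun vw x => D vw x) (fun _ _ => 1%N)).
    by apply: eq_bigr => vw _; rewrite -sum1_card.
  apply/fintype.subset_leq_card/fintype.subsetP => _ /fintype.imageP [[[x y] [z w]] h ->].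
  exact/eqP/(kloo_quad_eq0 h).
rewrite -mulnn big_distrlr /= pair_big big_distrr /=; apply: leq_sum => -[v w] _ /=.
apply: (@leq_trans (ann (2%:R : A) * ann (v * w)%R)%N).
  rewrite (eq_card (B := [pred x | [pred y | (v * w) * y == 0] (2%:R * x + (v + w))])).
    by apply: card_preim_leq => y; exact: card_affine_preim.
  by move=> x; rewrite !inE mulrC.
by rewrite leq_mul2l [(ann v * _)%N]mulnC annM orbT.
Qed.
End Kloosterman.

Section KloostermanSums.
Variables (A : finComUnitRingType) (C : numClosedFieldType) (e : A -> C).
Hypothesis eD : {morph e : x y / x + y >-> x * y}.
Hypothesis e_conj : forall x : A, (e x)^* = e (- x).
Hypothesis e_orth : forall x : A, \sum_m e (m * x) = if x == 0 then #|A|%:R else 0.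
Implicit Types (m n x y z u : A).

(** Parseval: after expanding the square, summation over m forces f i = f j and summation over n
    forces g i = g j. *)
Lemma second_moment (I : finType) (P : pred I) (f g : I -> A) :
  \sum_m \sum_n `|\sum_(i | P i) e (m * f i + n * g i)| ^+ 2 =
  (#|A| ^ 2 * #|[pred ij : I * I | [&& P ij.1, P ij.2,
                  f ij.1 == f ij.2 & g ij.1 == g ij.2]]|)%:R.
Proof.
have E m n : `|\sum_(i | P i) e (m * f i + n * g i)| ^+ 2 =
   \sum_(ij : I * I | P ij.1 && P ij.2) e (m * (f ij.1 - f ij.2)) * e (n * (g ij.1 - g ij.2)).
  rewrite normCK rmorph_sum big_distrlr pair_big /=.
  by apply: eq_bigr => -[i j] _ /=; rewrite e_conj -!eD; congr e; ring.
under eq_bigr => m _ do under eq_bigr => n _ do rewrite E.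
under eq_bigr => m _ do rewrite exchange_big /=.
rewrite exchange_big /=.
under eq_bigr => ij _.
  under eq_bigr => m _ do rewrite -mulr_sumr.
  rewrite -mulr_suml !e_orth.
  over.
rewrite /= natrM -[X in _ * X%:R]sum1_card natr_sum mulr_sumr [RHS]big_mkcond [LHS]big_mkcond /=.
apply: eq_bigr => -[i j] _ /=; rewrite /in_mem /= !subr_eq0.
by case: (P i); case: (P j); case: eqP; case: eqP; rewrite ?mulr0 ?mul0r //= mulr1 natrX.
Qed.

Definition kloo m n : C := \sum_(x | x \is a GRing.unit) e (m * x + n * x^-1).

(** The square of a Kloosterman sum is an exponential sum over pairs (x, y) with phases x + y and
    1/x + 1/y, so its second moment applies. *)
Lemma kloo_fourth_moment :
  \sum_m \sum_n `|kloo m n| ^+ 4 = (#|A| ^ 2 * #|@kloo_quad A|)%:R.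
Proof.
pose f (p : A * A) := p.1 + p.2; pose g (p : A * A) := p.1^-1 + p.2^-1.
pose P (p : A * A) := (p.1 \is a GRing.unit) && (p.2 \is a GRing.unit).
transitivity (\sum_m \sum_n `|\sum_(p | P p) e (m * f p + n * g p)| ^+ 2).
  apply: eq_bigr => m _; apply: eq_bigr => n _.
  have -> : `|kloo m n| ^+ 4 = `|kloo m n * kloo m n| ^+ 2 by rewrite normrM; ring.
  rewrite /kloo big_distrlr pair_big /=.
  congr (`|_| ^+ 2); apply: eq_bigr => -[x y] _ /=.
  by rewrite -eD /f /g /=; congr e; ring.
rewrite second_moment; congr (_ * _)%:R; exact: eq_card.
Qed.

Lemma klooMV m n u : u \is a GRing.unit -> kloo (m * u) (n * u^-1) = kloo m n.
Proof.
move=> uu; rewrite /kloo [RHS](reindex_inj (mulrI uu)) /=.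
apply: eq_big => x; first by rewrite unitrMr.
by move=> ux; rewrite invrM //; congr e; ring.
Qed.

(** By [klooMV] the value at (m, n) recurs at (m u, n / u) for every unit u. A given point arises
    from at most [ann n] units, since its second coordinate fixes n / u; the fourth moment therefore
    bounds a single sum. *)
Lemma kloo_bound m n :
  #|[pred u : A | u \is a GRing.unit]|%:R * `|kloo m n| ^+ 4
  <= (ann n * (#|A| ^ 2 * #|@kloo_quad A|))%:R.
Proof.
rewrite natrM -kloo_fourth_moment pair_big /= mulr_sumr.
rewrite mulr_natl -sumr_const.
have -> : \sum_(u in [pred u : A | u \is a GRing.unit]) `|kloo m n| ^+ 4
   = \sum_(p : A * A) \sum_(u | (u \is a GRing.unit) && ((m * u, n * u^-1) == p))
       `|kloo p.1 p.2| ^+ 4.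
  rewrite (partition_big (fun u => (m * u, n * u^-1)) predT) //=.
  apply: eq_bigr => p _; apply: eq_bigr => u /andP[uu /eqP <-] /=.
  by rewrite klooMV.
apply: ler_sum => p _; rewrite sumr_const -[leLHS]mulr_natl ler_wpM2r ?exprn_ge0 //.
rewrite ler_nat; apply: leq_trans (card_affine_preim n 0 p.2).
rewrite -(fintype.card_image invr_inj); apply/fintype.subset_leq_card.
apply/fintype.subsetP => _ /fintype.imageP[u hu ->].
by move: hu; rewrite /in_mem /= addr0 => /andP[_ /eqP <-].
Qed.

End KloostermanSums.

(** * Divisors, totients and annihilators modulo q *)

Lemma perm_cat_notin (T : eqType) (s1 s2 : seq T) :
  uniq s1 -> uniq s2 -> {subset s1 <= s2} ->
  perm_eq s2 (s1 ++ [seq x <- s2 | x \notin s1]).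
Proof.
move=> u1 u2 sub; apply: uniq_perm => // [|x].
  rewrite cat_uniq u1 filter_uniq // andbT /=.
  by apply/hasPn => x; rewrite mem_filter => /andP[].
rewrite mem_cat mem_filter; case: (boolP (x \in s1)) => //= xs.
by rewrite (sub _ xs).
Qed.

Definition ndiv (n : nat) : nat := size (divisors n).

(** With g = gcd(n, q), n x = 0 modulo q forces q / g to divide x, and the quotient takes fewer than
    g + 1 values. *)
Lemma ann_Zp p (n : 'I_p.+2) : (ann n <= gcdn n p.+2)%N.
Proof.
have g0 : (0 < gcdn n p.+2)%N by rewrite gcdn_gt0 orbT.
set g := gcdn n p.+2 in g0 *; pose r := (p.+2 %/ g)%N.
have hr : (r * g = p.+2)%N by rewrite divnK // dvdn_gcdr.
have r0 : (0 < r)%N by rewrite lt0n; apply/eqP => r0; move: hr; rewrite r0.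
have hdiv (x : 'I_p.+2) : n * x == 0 -> (r %| x)%N.
  move/eqP/(congr1 val) => /= /eqP; rewrite -/(dvdn _ _) => h.
  rewrite -(@Gauss_dvdr r (n %/ g)%N x); last first.
    by rewrite /r /g coprime_sym /coprime -(eqn_pmul2l g0) muln_gcdr !(mulnC g)
      !divnK ?dvdn_gcdl ?dvdn_gcdr // mul1n.
  rewrite -(dvdn_pmul2r g0) hr mulnAC divnK ?dvdn_gcdl //.
have lt_g (x : 'I_p.+2) : (x %/ r < g)%N by rewrite ltn_divLR // mulnC hr.
pose f (x : 'I_p.+2) : 'I_g := Ordinal (lt_g x).
rewrite -[leqRHS]card_ord /ann -(@fintype.card_in_image _ _ f); first exact: max_card.
move=> x y; rewrite !inE => hx hy /(congr1 val) /= hxy; apply: val_inj => /=.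
by rewrite -(divnK (hdiv x hx)) -(divnK (hdiv y hy)) hxy.
Qed.

Lemma ann2_Zp p : (ann (2%:R : 'I_p.+2) <= 2)%N.
Proof.
apply: leq_trans (ann_Zp _) _; case: p => [//|p].
by apply: dvdn_leq => //; exact: dvdn_gcdl.
Qed.

Lemma leq_sum_dvd_gcd q n : (0 < q)%N ->
  (gcdn n q <= \sum_(g <- divisors q | g %| n) g)%N.
Proof.
move=> q0; rewrite (big_rem (gcdn n q)) /=; last first.
  by rewrite -dvdn_divisors // dvdn_gcdr.
by rewrite dvdn_gcdl leq_addr.
Qed.

Lemma sum_dvd_ord q g : (g %| q)%N -> (\sum_(u < q) (g %| u) = q %/ g)%N.
Proof.
case: q => [|q] gq; first by rewrite big_ord0 div0n.
rewrite divn_count_dvd -(big_mkord predT (fun u => (g %| u)%N : nat)).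
by rewrite [LHS]big_nat_recl // [RHS]big_add1 [RHS]big_nat_recr //= gq dvdn0 addnC.
Qed.

(** Once gcd(u, q) is bounded by the sum of the common divisors of u and q, each divisor g of q
    contributes g for each of the q / g multiples of g, that is q in total. *)
Lemma sum_ann_Zp p : (\sum_(u : 'I_p.+2) ann u <= p.+2 * ndiv p.+2)%N.
Proof.
apply: (@leq_trans (\sum_(u < p.+2) \sum_(g <- divisors p.+2) g * (g %| u))%N).
  apply: leq_sum => u _; apply: leq_trans (ann_Zp u) _.
  apply: leq_trans (leq_sum_dvd_gcd _ _) _ => //.
  by rewrite big_mkcond; apply: leq_sum => g _; case: ifP; rewrite ?muln1.
rewrite exchange_big /= /ndiv mulnC -sum1_size big_distrl /=.
rewrite big_seq [leqRHS]big_seq; apply: leq_sum => g; rewrite -dvdn_divisors // => gq.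
by rewrite -big_distrr /= sum_dvd_ord // mulnC divnK // mul1n.
Qed.

Lemma leq_totient_dvd d n : (0 < n)%N -> (d %| n)%N -> (totient d <= totient n)%N.
Proof.
move=> n0 dn; have d0 : (0 < d)%N by apply: dvdn_gt0 dn.
have sub : {subset primes d <= primes n}.
  by move=> r; rewrite !mem_primes n0 d0 /= => /andP[-> /dvdn_trans ->].
have perm_n := perm_cat_notin (primes_uniq d) (primes_uniq n) sub.
rewrite !totientE // (perm_big _ perm_n) big_cat /= -[leqLHS]muln1; apply: leq_mul.
  rewrite big_seq [leqRHS]big_seq; apply: leq_prod => r.
  rewrite mem_primes => /andP[r_pr _]; rewrite leq_mul2l leq_exp2l ?prime_gt1 //.
  by rewrite -!subn1 leq_sub2r ?orbT // dvdn_leq_log.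
rewrite big_seq; apply: prodn_cond_gt0 => r; rewrite mem_filter mem_primes.
by case/and4P => _ r_pr _ _; 
  rewrite muln_gt0 expn_gt0 (prime_gt0 r_pr) andbT -ltnS prednK ?prime_gt0 ?prime_gt1.
Qed.

(** In Gauss's identity, n is the sum of [totient d] over the divisors d of n, and each term is at
    most [totient n]. *)
Lemma leq_totient_ndiv n : (0 < n)%N -> (n <= totient n * ndiv n)%N.
Proof.
move=> n0; rewrite -[leqLHS]sum_totient_dvd.
apply: (@leq_trans (\sum_(d < n.+1 | d %| n) totient n)%N).
  by apply: leq_sum => d dn; exact: leq_totient_dvd.
rewrite sum_nat_const mulnC leq_mul2l; apply/orP; right.
rewrite /ndiv cardE -(size_map val); apply: uniq_leq_size.
  by rewrite (map_inj_uniq val_inj) enum_uniq.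
move=> _ /mapP[d + ->]; rewrite mem_enum => dn.
by rewrite -dvdn_divisors //; exact: dn.
Qed.

Lemma card_unit_Zp p : #|[pred u : 'I_p.+2 | u \is a GRing.unit]| = totient p.+2.
Proof.
rewrite totient_count_coprime big_mkord -sum1_card big_mkcond; apply: eq_bigr => u _.
by rewrite inE -[u in LHS]natr_Zp (@unitZpE p.+2) //.
Qed.

(** There are at most 2 (q d(q))^2 quadruples, d(q) being the number of divisors, and at least q /
    d(q) units. The fourth root has the exponent 3/4 in q. *)
Lemma kloo_bound_Zp p (C : numClosedFieldType) (e : 'I_p.+2 -> C) (m n : 'I_p.+2) :
  {morph e : x y / x + y >-> x * y} ->
  (forall x : 'I_p.+2, (e x)^* = e (- x)) ->
  (forall x, \sum_m e (m * x) = if x == 0 then p.+2%:R else 0) ->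
  `|kloo e m n| ^+ 4 <= (2 * gcdn n p.+2 * p.+2 ^ 3 * ndiv p.+2 ^ 3)%:R.
Proof.
move=> eD eC eO; have eO' (x : 'I_p.+2) :
  \sum_m e (m * x) = if x == 0 then #|'I_p.+2|%:R else 0 by rewrite card_ord.
have := kloo_bound eD eC eO' m n.
rewrite card_unit_Zp card_ord => h.
set q := p.+2 in h *; set d := ndiv q.
have q0 : (0 : C) < q%:R by rewrite ltr0n.
rewrite -(ler_pM2l q0).
apply: (@le_trans _ _ ((totient q * d)%:R * `|kloo e m n| ^+ 4)).
  by rewrite ler_wpM2r ?exprn_ge0 // ler_nat leq_totient_ndiv.
rewrite natrM [_ * d%:R]mulrC -mulrA.
apply: (@le_trans _ _ (d%:R * (gcdn n q * (q ^ 2 * (2 * (q * d) ^ 2)))%:R)).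
  rewrite ler_wpM2l ?ler0n //; apply: le_trans h _; rewrite ler_nat.
  apply: leq_mul; first exact: ann_Zp.
  rewrite leq_mul2l; apply/orP; right; apply: leq_trans (card_kloo_quad _) _.
  apply: leq_mul; first exact: ann2_Zp.
  by rewrite leq_exp2r // sum_ann_Zp.
by rewrite -!natrM ler_nat; apply: eq_leq; ring.
Qed.

(** * Points of a modular hyperbola in a polygon *)

(** The upper end is excluded: [harm F n.+1] is the harmonic number H_n. *)
Definition harm (F : fieldType) (n : nat) : F := \sum_(1 <= k < n) k%:R^-1.

Lemma ler_sum_sub_uniq (F : numDomainType) (T : eqType) (s1 s2 : seq T) (f : T -> F) :
  uniq s1 -> uniq s2 -> {subset s1 <= s2} -> {in s2, forall x, 0 <= f x} ->
  \sum_(x <- s1) f x <= \sum_(x <- s2) f x.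
Proof.
move=> u1 u2 sub f0; rewrite (perm_big _ (perm_cat_notin u1 u2 sub)) big_cat lerDl.
by rewrite big_seq sumr_ge0 // => x; rewrite mem_filter => /andP[_ /f0].
Qed.

Lemma sum_dvd_harm (F : numFieldType) (g n : nat) : (0 < g)%N ->
  \sum_(1 <= k < n | (g %| k)%N) g%:R / k%:R <= harm F n.
Proof.
move=> g0; rewrite -big_filter.
have -> : \sum_(k <- [seq k <- index_iota 1 n | (g %| k)%N]) g%:R / k%:R =
    \sum_(i <- [seq (k %/ g)%N | k <- index_iota 1 n & (g %| k)%N]) i%:R^-1 :> F.
  rewrite big_map big_seq [RHS]big_seq; apply: eq_bigr => k.
  rewrite mem_filter mem_index_iota => /andP[gk /andP[k0 _]].
  rewrite -{1}(divnK gk) natrM invfM mulrCA divff ?mulr1 //.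
  by rewrite pnatr_eq0 -lt0n.
apply: ler_sum_sub_uniq; rewrite ?iota_uniq //.
- rewrite map_inj_in_uniq ?filter_uniq ?iota_uniq // => x y.
  by rewrite !mem_filter => /andP[gx _] /andP[gy _] exy; rewrite -(divnK gx) exy divnK.
- move=> _ /mapP[k + ->]; rewrite mem_filter !mem_index_iota => /and3P[gk k0 kn].
  by rewrite divn_gt0 // dvdn_leq //= (leq_ltn_trans (leq_div _ _) kn).
Qed.

(** The gcd is at most the sum of the common divisors g, and the multiples of g contribute g / (g i)
    = 1 / i each. *)
Lemma sum_gcd_harm (F : numFieldType) (q : nat) : (0 < q)%N ->
  \sum_(1 <= n < q) (gcdn n q)%:R / n%:R <= (ndiv q)%:R * harm F q.
Proof.
move=> q0; apply: (@le_trans _ _ (\sum_(1 <= n < q)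
    \sum_(g <- divisors q | (g %| n)%N) g%:R / n%:R)).
  apply: ler_sum => n _; rewrite -mulr_suml ler_wpM2r ?invr_ge0 ?ler0n //.
  by rewrite -natr_sum ler_nat leq_sum_dvd_gcd.
rewrite (exchange_big_dep predT) //= /ndiv -sum1_size natr_sum mulr_suml.
rewrite big_seq [leRHS]big_seq; apply: ler_sum => g; rewrite -dvdn_divisors // => gq.
by rewrite mul1r sum_dvd_harm // (dvdn_gt0 q0).
Qed.

(** * Additive characters and incomplete Kloosterman sums *)

Section AdditiveCharacter.
Variables (p : nat) (C : numClosedFieldType) (z : C).
Local Notation q := p.+2.
Hypothesis z_prim : q.-primitive_root z.
(** The metric input on the root: for exp(2 pi i / q) these powers lie in the closed left
    half-plane. Stated this way, the estimates make sense in any [numClosedFieldType]. *)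
Hypothesis z_far : forall k, (q <= 4 * k <= 3 * q)%N -> 1 <= `|1 - z ^+ k|.

Definition zchar (x : 'I_q) : C := z ^+ x.
Local Notation e := zchar.

Lemma norm_zroot k : `|z ^+ k| = 1.
Proof.
rewrite normrX; suff -> : `|z| = 1 by rewrite expr1n.
by apply/eqP; rewrite -(@pexpr_eq1 _ _ q) // -normrX prim_expr_order // normr1.
Qed.

Lemma zcharD : {morph e : x y / x + y >-> x * y}.
Proof. by move=> x y; rewrite /e -exprD -(prim_expr_mod z_prim (x + y)). Qed.

Lemma zchar0 : e 0 = 1. Proof. by rewrite /e expr0. Qed.

Lemma zcharN x : (e x)^* = e (- x).
Proof.
have ex0 : e x != 0 by rewrite -normr_eq0 norm_zroot oner_eq0.
apply: (mulfI ex0); rewrite -normCK norm_zroot -zcharD subrr zchar0.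
by rewrite expr1n.
Qed.

Lemma zchar_eq1 x : (e x == 1) = (x == 0).
Proof. by rewrite /e -(prim_order_dvd z_prim) /dvdn modn_small. Qed.

Lemma zcharM_nat x k : e (x * k%:R) = e x ^+ k.
Proof.
elim: k => [|k IHk]; first by rewrite mulr0 zchar0 expr0.
by rewrite mulrSr mulrDr mulr1 zcharD IHk exprSr.
Qed.

Lemma zchar_orth (x : 'I_q) : \sum_m e (m * x) = if x == 0 then q%:R else 0.
Proof.
case: eqP => [->|/eqP x0].
  under eq_bigr do rewrite mulr0 zchar0.
  by rewrite sumr_const card_ord.
have e1 : e x - 1 != 0 by rewrite subr_eq0 zchar_eq1.
apply: (mulfI e1); rewrite mulr0.
have -> : \sum_m e (m * x) = \sum_(i < q) e x ^+ i.
  by apply: eq_bigr => i _; rewrite -zcharM_nat natr_Zp mulrC.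
by rewrite -subrX1 /e exprAC (prim_expr_order z_prim) expr1n subrr.
Qed.

Lemma norm_1Bzroot_sub k : (k <= q)%N -> `|1 - z ^+ (q - k)| = `|1 - z ^+ k|.
Proof.
move=> kq; rewrite -[LHS]mul1r -{1}(norm_zroot k) -normrM mulrBr mulr1 -exprD.
by rewrite subnKC // (prim_expr_order z_prim) distrC.
Qed.

Lemma norm_1BX_le k j : `|1 - z ^+ (k * j)| <= j%:R * `|1 - z ^+ k|.
Proof.
rewrite exprM distrC subrX1 normrM distrC mulrC ler_wpM2r //.
apply: le_trans (ler_norm_sum _ _ _) _.
under eq_bigr do rewrite -exprM norm_zroot.
by rewrite sumr_const card_ord.
Qed.

(* If 4k < q, some multiple jk with j <= q / k has q <= 4jk <= 3q, where
   |1 - z^(jk)| >= 1. *)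
Lemma inv_1Bzroot_half k : (0 < k)%N -> (2 * k <= q)%N ->
  `|1 - z ^+ k|^-1 <= q%:R * k%:R^-1.
Proof.
move=> k0 kq; have kC : (0 : C) < k%:R by rewrite ltr0n.
pose j := (q %/ (4 * k)).+1.
have k4 : (0 < 4 * k)%N by lia.
have hj1 : (q < j * (4 * k))%N by rewrite ltn_ceil.
have hj2 : (j.-1 * (4 * k) <= q)%N by rewrite leq_divM.
have [hk|hk] := leqP q (4 * k); last first.
  have hj : (j * k <= q)%N by rewrite /j /= in hj2 *; nia.
  have h1 : 1 <= j%:R * `|1 - z ^+ k|.
    apply: le_trans (norm_1BX_le k j); apply: z_far.
    by rewrite /j /= in hj1 hj2 *; apply/andP; split; nia.
  have n0 : 0 < `|1 - z ^+ k|.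
    by rewrite lt0r normr_ge0 andbT; apply: contraTneq h1 => ->; rewrite mulr0 ler10.
  rewrite ler_pdivlMr // mulrC ler_pdivrMr //.
  apply: (@le_trans _ _ (k%:R * (j%:R * `|1 - z ^+ k|))).
    by rewrite -[leLHS]mulr1 ler_wpM2l // ltW.
  by rewrite mulrA -natrM ler_wpM2r // ler_nat mulnC.
have h1 : 1 <= `|1 - z ^+ k| by apply: z_far; lia.
apply: (@le_trans _ _ 1); first by rewrite invf_le1 // (lt_le_trans ltr01).
by rewrite ler_pdivlMr // mul1r ler_nat; lia.
Qed.

(** The sum of the two reciprocals stands for the inverse distance from k to the nearest multiple of
    q; z^(q - k) and z^k are equally far from 1. *)
Lemma inv_1Bzroot k : (0 < k < q)%N ->
  `|1 - z ^+ k|^-1 <= q%:R * (k%:R^-1 + (q - k)%:R^-1).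
Proof.
case/andP=> k0 kq; rewrite mulrDr; have [hk|hk] := leqP (2 * k) q.
  apply: le_trans (inv_1Bzroot_half k0 hk) _.
  by rewrite lerDl mulr_ge0 ?invr_ge0 ?ler0n.
rewrite -(norm_1Bzroot_sub (ltnW kq)).
apply: le_trans (inv_1Bzroot_half _ _) _; rewrite ?subn_gt0 //; first lia.
by rewrite lerDr mulr_ge0 ?invr_ge0 ?ler0n.
Qed.

Lemma norm_geom_le k a b : (a <= b)%N -> z ^+ k != 1 ->
  `|\sum_(a <= j < b) (z ^+ k) ^+ j| <= 2 * `|1 - z ^+ k|^-1.
Proof.
move=> ab w1; have n0 : 0 < `|1 - z ^+ k| by rewrite normr_gt0 subr_eq0 eq_sym.
rewrite ler_pdivlMr // -normrM mulrBr mulr1 mulr_suml -sumrB.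
under eq_bigr do rewrite -exprSr -opprB.
rewrite sumrN telescope_sumr // normrN.
apply: le_trans (ler_normB _ _) _; rewrite -!exprM !norm_zroot.
exact: lexx.
Qed.

Lemma big_ord_itv (F : nat -> C) (a b n : nat) : (b <= n)%N ->
  \sum_(j < n | (a <= j < b)%N) F j = \sum_(a <= j < b) F j.
Proof.
move=> bn; rewrite -(big_mkord (fun j => (a <= j < b)%N) F).
rewrite (big_nat_widen _ _ _ _ _ bn) [RHS](big_nat_widenl _ 0%N) //=.
by apply: eq_bigl => j; rewrite andbC.
Qed.

Lemma sum_ordN0 (F : nat -> C) :
  \sum_(k < q | k != ord0) F k = \sum_(1 <= k < q) F k.
Proof.
rewrite -(@big_ord_itv F 1 q q) //; apply: eq_bigl => k.
by rewrite ltn_ord andbT lt0n.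
Qed.

Lemma harm_rev : \sum_(1 <= k < q) (q - k)%:R^-1 = harm C q.
Proof.
rewrite big_nat_rev /= /harm big_nat [RHS]big_nat; apply: eq_bigr => k /andP[k1 kq].
by rewrite add1n subSS subKn // ltnW.
Qed.

(** The l^1 norm of the Fourier transform of an interval: frequency 0 gives at most q, the others
    are geometric sums of size at most 2 / |1 - z^k|. *)
Lemma sum_norm_itv_zchar a b : (a <= b <= q)%N ->
  \sum_(k < q) `|\sum_(j < q | (a <= j < b)%N) e (k * j)| <= q%:R * (1 + 4 * harm C q).
Proof.
case/andP=> ab bq; rewrite (bigD1 ord0) //= mulrDr mulr1; apply: lerD.
  apply: le_trans (ler_norm_sum _ _ _) _.
  under eq_bigr do rewrite norm_zroot.
  rewrite -[X in _ <= X%:R]card_ord -[X in _ <= X]sumr_const big_mkcond.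
  by apply: ler_sum => j _; case: ifP => // _; rewrite ler01.
apply: (@le_trans _ _ (\sum_(k < q | k != ord0) 2 * (q%:R * (k%:R^-1 + (q - k)%:R^-1)))).
  apply: ler_sum => k k0.
  have -> : \sum_(j < q | (a <= j < b)%N) e (k * j) = \sum_(a <= j < b) (z ^+ k) ^+ j.
    rewrite -(@big_ord_itv _ a b q) //; apply: eq_bigr => j _.
    by rewrite -[j in LHS]natr_Zp zcharM_nat.
  apply: le_trans (norm_geom_le _ _) _; rewrite ?zchar_eq1 //.
  by rewrite ler_pM2l ?ltr0n // inv_1Bzroot // ltn_ord lt0n k0.
rewrite (sum_ordN0 (fun k => 2 * (q%:R * (k%:R^-1 + (q - k)%:R^-1)))).
rewrite -!mulr_sumr big_split /= harm_rev -/(harm C q).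
have -> : 2 * (q%:R * (harm C q + harm C q)) = q%:R * (4 * harm C q) by ring.
exact: lexx.
Qed.

Variable kappa : C.
Hypothesis kappa_bound : forall m n : 'I_q, `|kloo e m n| <= (gcdn n q)%:R * kappa.

Lemma kappa_ge0 : 0 <= kappa.
Proof.
have := le_trans (normr_ge0 _) (kappa_bound 1 1).
by rewrite pmulr_rge0 // ltr0n gcdn_gt0 orbT.
Qed.

Definition ikloo (m n : 'I_q) (a b : nat) : C :=
  \sum_(x : 'I_q | (x \is a GRing.unit) && (a <= x < b)%N) e (m * x + n * x^-1).

(** Completion: the condition that x lies in the interval is detected by orthogonality, and the
    detecting frequency k is absorbed into the first argument of a complete sum. *)
Lemma ikloo_completion m n a b :
  q%:R * ikloo m n a b =
  \sum_k (\sum_(j < q | (a <= j < b)%N) e (k * j)) * kloo e (m - k) n.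
Proof.
under eq_bigr do rewrite big_distrlr /=.
rewrite exchange_big /=; under eq_bigr do rewrite exchange_big /=.
rewrite exchange_big /= /ikloo mulr_sumr big_mkcondr /=.
apply: eq_bigr => x ux.
have E (j : 'I_q) : \sum_k e (k * j) * e ((m - k) * x + n / x) =
    e (m * x + n / x) * (if j == x then q%:R else 0).
  rewrite -[j == x]subr_eq0 -zchar_orth mulr_sumr; apply: eq_bigr => k _.
  by rewrite -!zcharD; congr e; ring.
under eq_bigr do rewrite E.
rewrite -mulr_sumr -big_mkcondr /=.
case: ifP => hx; last first.
  rewrite big_pred0 ?mulr0 // => j; apply/negP => /andP[+ /eqP ejx].
  by rewrite ejx hx.
rewrite (big_pred1 x) 1?mulrC // => j.
by rewrite /= andbC; case: eqP => [->|]; rewrite ?hx.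
Qed.

(** The shift by k leaves n alone, so every complete sum obeys the same bound gcd(n, q) [kappa]. *)
Lemma norm_ikloo_le m n a b : (a <= b <= q)%N ->
  `|ikloo m n a b| <= (gcdn n q)%:R * kappa * (1 + 4 * harm C q).
Proof.
move=> abq; have q0 : (0 : C) < q%:R by rewrite ltr0n.
rewrite -(ler_pM2l q0) -[X in X * _ <= _]normr_nat -normrM ikloo_completion.
apply: le_trans (ler_norm_sum _ _ _) _.
rewrite mulrCA; apply: (@le_trans _ _ ((gcdn n q)%:R * kappa *
  \sum_(k < q) `|\sum_(j < q | (a <= j < b)%N) e (k * j)|)); last first.
  apply: ler_wpM2l (sum_norm_itv_zchar abq).
  by rewrite mulr_ge0 ?ler0n ?kappa_ge0.
rewrite mulr_sumr; apply: ler_sum => k _.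
by rewrite normrM mulrC ler_wpM2r.
Qed.
End AdditiveCharacter.

Lemma gcdn_subl n q : (n <= q)%N -> gcdn (q - n) q = gcdn n q.
Proof.
move=> nq; have -> : gcdn n q = gcdn n (q - n) by rewrite -{1}(subnK nq) gcdnDr.
by rewrite -{2}(subnK nq) gcdnDl gcdnC.
Qed.

(** * Fourier expansion of the count on the modular hyperbola *)

Definition inv_count (p X T : nat) : nat :=
  #|[pred x : 'I_p.+2 | [&& x \is a GRing.unit, (x <= X)%N & (x + (x^-1)%R <= T)%N]]|.

Section InverseCount.
Variables (p : nat) (C : numClosedFieldType) (z : C).
Local Notation q := p.+2.
Hypothesis z_prim : q.-primitive_root z.
Hypothesis z_far : forall k, (q <= 4 * k <= 3 * q)%N -> 1 <= `|1 - z ^+ k|.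
Variable kappa : C.
Local Notation e := (zchar z : 'I_q -> C).
Hypothesis kappa_bound : forall m n : 'I_q, `|kloo e m n| <= (gcdn n q)%:R * kappa.
Variables X T : nat.
(** The column above x is 1 <= y <= [Y x]. The x in [[lo], [hi]) are those with x <= X and 0 < T - x
    < q, where the column ends on the line x + y = T; otherwise it is full, empty or cut off by X.
    The [maxn] keeps [lo <= hi]. *)
Local Notation Y := (fun x : 'I_q => minn q (T - x)).
Local Notation lo := (minn q (T.+1 - q)).
Local Notation hi := (maxn lo (minn q (minn X.+1 T))).

Lemma sum_eq_natr (v : 'I_q) (N : nat) : v != 0 -> (N <= q)%N ->
  (\sum_(1 <= y < N.+1) (v == y%:R))%N = (v <= N)%N.
Proof.
move=> v0 Nq; have v1 : (0 < v)%N by rewrite lt0n.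
have E y : (y \in index_iota 1 N.+1) -> (v == y%:R) = (y == v :> nat).
  rewrite mem_index_iota => /andP[y1 yN].
  rewrite -val_eqE /= (@val_Zp_nat q isT y).
  have [yq|yq] := ltnP y q; first by rewrite modn_small // eq_sym.
  (* The height y = q represents the residue 0, which differs from v. *)
  have -> : y = q by apply/eqP; rewrite eqn_leq yq andbT (leq_trans _ Nq).
  rewrite modnn; have := ltn_ord v; lia.
have [vN|vN] := leqP v N.
  rewrite (bigD1_seq (v : nat)) ?iota_uniq //= ?mem_index_iota ?v1 //.
  rewrite natr_Zp eqxx big_seq_cond big1 // => y /andP[yi ynv].
  by rewrite E // (negbTE ynv).
rewrite big_seq big1 // => y yi; rewrite E //.
by move: yi; rewrite mem_index_iota; case: eqP => // ->; lia.
Qed.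

Lemma unit_Zp_neq0 (x : 'I_q) : x \is a GRing.unit -> x != 0.
Proof. by apply: contraTneq => ->; rewrite unitr0. Qed.

(** Orthogonality in n detects the equality of x^-1 with some height y of the column. *)
Lemma inv_term (x : 'I_q) : x \is a GRing.unit ->
  \sum_n e (n * x^-1) * \sum_(1 <= y < (Y x).+1) e (- n) ^+ y =
  q%:R * ((x^-1 <= Y x)%N : nat)%:R.
Proof.
move=> ux; have vN0 : x^-1 != 0 by rewrite unit_Zp_neq0 ?unitrV.
rewrite -(sum_eq_natr vN0 (geq_minl q (T - x))) natr_sum mulr_sumr; under eq_bigr do rewrite mulr_sumr.
rewrite exchange_big /=; apply: eq_bigr => y _.
transitivity (\sum_n e (n * (x^-1 - y%:R))).
  by apply: eq_bigr => n _; rewrite mulrBr zcharD // -zcharM_nat // mulNr.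
by rewrite zchar_orth // subr_eq0; case: eqP; rewrite ?mulr1 ?mulr0.
Qed.

Lemma inv_count_fourier : q%:R * (inv_count p X T)%:R =
  \sum_n \sum_(x : 'I_q | (x \is a GRing.unit) && (x <= X)%N)
    e (n * x^-1) * \sum_(1 <= y < (Y x).+1) e (- n) ^+ y.
Proof.
rewrite exchange_big /= /inv_count -sum1_card natr_sum mulr_sumr.
rewrite big_mkcond [RHS]big_mkcond; apply: eq_bigr => x _ /=.
rewrite inE andbA; case: ifP => /= [/andP[/andP[ux xX] hT]|]; last first.
  case: ifP => //= /andP[ux xX] /negbT; rewrite -ltnNge => hT.
  (* When T < x the truncated T - x is 0, and positivity of the inverse still excludes x^-1 <= T -
     x. *)
  have v0 : (0 < (x^-1)%R)%N by rewrite lt0n (unit_Zp_neq0 (x := x^-1)) ?unitrV.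
  rewrite (inv_term ux) //; case: leqP; rewrite ?mulr0 // => hv; exfalso.
  by move: (nat_of_ord x^-1) hv v0 hT => v; lia.
rewrite ux xX (inv_term ux) //; case: leqP => // hv; exfalso.
by move: (nat_of_ord x^-1) hv hT (ltn_ord x^-1) => v; lia.
Qed.

(** Multiplied by 1 - e(-n), the geometric sum of a column telescopes to e(-n) - e(-n)^(Y x + 1).
    This vanishes on full and empty columns. On the sloping ones Y x = T - x, so the result is a
    difference of two incomplete Kloosterman sums, both with second argument n. *)
Lemma hyperbola_sum_neq0 (n : 'I_q) : n != 0 ->
  `|\sum_(x : 'I_q | (x \is a GRing.unit) && (x <= X)%N)
    e (n * x^-1) * \sum_(1 <= y < (Y x).+1) e (- n) ^+ y|
  <= `|1 - z ^+ n|^-1 * (2 * ((gcdn n q)%:R * kappa * (1 + 4 * harm C q))).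
Proof.
move=> n0; set S := \sum_(x | _) _.
have w1 : 0 < `|1 - z ^+ n|.
  by rewrite normr_gt0 subr_eq0 eq_sym -/(zchar z n) zchar_eq1.
have nw : `|1 - e (- n)| = `|1 - z ^+ n|.
  by rewrite -(zcharN z_prim) -[1 in LHS]conjC1 -rmorphB norm_conjC.
have key : (1 - e (- n)) * S =
    e (- n) * ikloo z 0 n lo hi - e (- n) ^+ T.+1 * ikloo z n n lo hi.
  rewrite /S /ikloo !mulr_sumr -sumrB big_mkcondr [RHS]big_mkcondr /=.
  apply: eq_bigr => x ux.
  have -> : (1 - e (- n)) * (e (n * x^-1) * \sum_(1 <= y < (Y x).+1) e (- n) ^+ y) =
      e (n * x^-1) * (e (- n) - e (- n) ^+ (Y x).+1).
    rewrite mulrCA; congr (_ * _); rewrite mulr_sumr.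
    under eq_bigr do rewrite mulrBl mul1r -exprS -opprB.
    by rewrite sumrN telescope_sumr // opprB.
  rewrite mul0r add0r zcharD //.
  have xq := ltn_ord x.
  have wq : e (- n) ^+ q = 1 by rewrite /zchar exprAC (prim_expr_order z_prim) expr1n.
  have [xX|xX] := leqP x X; last first.
    by case: ifP => // /andP[]; lia.
  have [h1|h1] := leqP q (T - x).
    rewrite exprS wq mulr1 subrr mulr0.
    by case: ifP => // /andP[]; lia.
  have [h2|h2] := leqP T x.
    have -> : (T - x = 0)%N by lia.
    rewrite expr1 subrr mulr0; case: ifP => // /andP[]; lia.
  case: ifP => [_|/negP[]]; last by apply/andP; lia.
  have -> : e (- n) ^+ T.+1 = e (- n) ^+ (T - x).+1 * e (- n) ^+ x.
    by rewrite -exprD; congr (_ ^+ _); lia.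
  have ex : e (- n) ^+ x * e (n * x) = 1.
    by rewrite -zcharM_nat // -zcharD // natr_Zp mulNr addNr zchar0.
  rewrite [X in _ = _ - X](_ : _ = e (- n) ^+ (T - x).+1 * e (n * x^-1)
     * (e (- n) ^+ x * e (n * x))); last by ring.
  by rewrite ex; ring.
rewrite mulrC ler_pdivlMr // -nw mulrC -normrM key.
have n1 : `|e (- n)| = 1 := norm_zroot z_prim (- n).
have n2 : `|e (- n) ^+ T.+1| = 1 by rewrite normrX n1 expr1n.
apply: le_trans (ler_normB _ _) _; rewrite !normrM n1 n2 !mul1r.
rewrite mulr_natl mulr2n; apply: lerD; apply: norm_ikloo_le => //; lia.
Qed.

Lemma inv_count_asymp :
  `|(inv_count p X T)%:R -
    (\sum_(x : 'I_q | (x \is a GRing.unit) && (x <= X)%N) Y x)%:R / q%:R|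
  <= 4 * kappa * (ndiv q)%:R * harm C q * (1 + 4 * harm C q).
Proof.
have q0 : (0 : C) < q%:R by rewrite ltr0n.
have k0 := kappa_ge0 kappa_bound.
have H0 : 0 <= harm C q by apply: sumr_ge0 => k _; rewrite invr_ge0 ler0n.
rewrite -(ler_pM2l q0) -[X in X * _ <= _]normr_nat -normrM mulrBr mulrCA divff ?gt_eqF //.
(* The frequency n = 0 is exactly the main term; all the others are error. *)
rewrite mulr1 inv_count_fourier (bigD1 ord0) //= addrAC.
rewrite [X in X - _ + _](_ : _ =
  (\sum_(x : 'I_q | (x \is a GRing.unit) && (x <= X)%N) Y x)%:R); last first.
  rewrite natr_sum; apply: eq_bigr => x _.
  rewrite mul0r zchar0 mul1r oppr0 zchar0.
  under eq_bigr do rewrite expr1n.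
  by rewrite sumr_const_nat subSS subn0.
rewrite subrr add0r; apply: le_trans (ler_norm_sum _ _ _) _.
set B := kappa * (1 + 4 * harm C q).
have B0 : 0 <= B by rewrite mulr_ge0 // addr_ge0 // mulr_ge0.
apply: (@le_trans _ _ (\sum_(n < q | n != ord0)
   2 * B * (q%:R * ((gcdn n q)%:R / n%:R + (gcdn (q - n) q)%:R / (q - n)%:R)))).
  apply: ler_sum => n n0; apply: le_trans (hyperbola_sum_neq0 n0) _.
  rewrite gcdn_subl ?(ltnW (ltn_ord n)) //.
  rewrite -mulrDr.
  have := inv_1Bzroot z_prim z_far (k := n); rewrite lt0n n0 ltn_ord => /(_ isT) h.
  apply: (@le_trans _ _ (q%:R * (n%:R^-1 + (q - n)%:R^-1) *
     (2 * ((gcdn n q)%:R * B)))).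
    rewrite -[_ * kappa * _]mulrA -/B; apply: ler_wpM2r h.
    by rewrite mulr_ge0 ?ler0n // mulr_ge0 ?ler0n.
  rewrite le_eqVlt; apply/orP; left; apply/eqP; ring.
pose F n : C := (gcdn n q)%:R / n%:R.
rewrite (@sum_ordN0 p C (fun n => 2 * B * (q%:R * (F n + F (q - n)%N)))).
rewrite -!mulr_sumr big_split /=.
have -> : \sum_(1 <= n < q) F (q - n)%N = \sum_(1 <= n < q) F n.
  rewrite big_nat_rev /= big_nat [RHS]big_nat; apply: eq_bigr => k /andP[k1 kq].
  by rewrite add1n subSS subKn // ltnW.
have hF := sum_gcd_harm C (ltn0Sn p.+1).
rewrite -/F in hF.
apply: (@le_trans _ _ (2 * B * (q%:R * ((ndiv q)%:R * harm C q + (ndiv q)%:R * harm C q)))).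
  apply: ler_wpM2l; first by rewrite mulr_ge0 ?ler0n.
  by apply: ler_wpM2l; [rewrite ler0n | apply: lerD].
rewrite /B le_eqVlt; apply/orP; left; apply/eqP; ring.
Qed.

End InverseCount.

(** * The root of unity exp(2 pi i / q) *)

Section ComplexRoot.
Variable R : realType.
Local Open Scope complex_scope.

Definition cis (x : R) : R[i] := cos x +i* sin x.

Lemma cisX (x : R) k : cis x ^+ k = cis (x * k%:R).
Proof.
elim: k => [|k IHk]; first by rewrite mulr0 /cis cos0 sin0 expr0.
rewrite exprS IHk -natr1 mulrDr mulr1 addrC /cis cosD sinD.
by apply/eqP; rewrite eq_complex /= eqxx /= addrC.
Qed.

Lemma cos_lt1 (x : R) : 0 < x < 2 * pi -> cos x < 1.
Proof.
case/andP=> x0 x1; have -> : x = x / 2 + x / 2 by lra.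
rewrite cosD -!expr2 cos2sin2.
have : 0 < sin (x / 2) by apply: sin_gt0_pi; lra.
by move=> h; have := exprn_gt0 2 h; lra.
Qed.

Lemma cos_le0 (x : R) : pi / 2 <= x <= 3 / 2 * pi -> cos x <= 0.
Proof.
case/andP=> h1 h2; have -> : x = (x - pi) + pi by lra.
rewrite cosDpi oppr_le0 cos_ge0_pihalf //; apply/andP; split; lra.
Qed.

Variable p : nat.
Local Notation q := p.+2.

Definition zeta_root : R[i] := cis (2 * pi / q%:R).

(** An order m < q would give cos(2 pi m / q) = 1 with an angle strictly between 0 and 2 pi. *)
Lemma zeta_root_prim : q.-primitive_root zeta_root.
Proof.
have q0 : (0 : R) < q%:R by rewrite ltr0n.
have zq : zeta_root ^+ q = 1.
  rewrite cisX mulfVK ?gt_eqF // /cis (_ : 2 * pi = pi + pi); last by ring.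
  rewrite cosD sinD cospi sinpi.
  by apply/eqP; rewrite eq_complex /=; apply/andP; split; apply/eqP; ring.
have [m mprim mq] := prim_order_exists (ltn0Sn p.+1) zq.
have m0 := prim_order_gt0 mprim.
have := dvdn_leq (ltn0Sn p.+1) mq; rewrite leq_eqVlt => /predU1P[<- //|mltq].
have := prim_expr_order mprim; rewrite cisX /cis => -[hcos _].
suff : cos (2 * pi / q%:R * m%:R) < 1 :> R by rewrite hcos ltxx.
apply: cos_lt1; rewrite !mulr_gt0 ?invr_gt0 ?pi_gt0 ?ltr0n //=.
by rewrite mulrAC ltr_pdivrMr // ltr_pM2l ?mulr_gt0 ?pi_gt0 // ltr_nat.
Qed.

Lemma zeta_root_far k : (q <= 4 * k <= 3 * q)%N -> 1 <= `|1 - zeta_root ^+ k|.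
Proof.
case/andP=> h1 h2; have q0 : (0 : R) < q%:R by rewrite ltr0n.
have h : cos (2 * pi / q%:R * k%:R) <= 0 :> R.
  apply: cos_le0; rewrite mulrAC ler_pdivlMr // ler_pdivrMr //.
  have e1 : pi * q%:R <= pi * (4 * k)%:R :> R by rewrite ler_wpM2l ?pi_ge0 ?ler_nat.
  have e2 : pi * (4 * k)%:R <= pi * (3 * q)%:R :> R by rewrite ler_wpM2l ?pi_ge0 ?ler_nat.
  by move: e1 e2; rewrite !natrM => e1 e2; apply/andP; split; lra.
rewrite /zeta_root cisX /cis normc_def /= -[1]/(1%:C) lecR.
rewrite -[leLHS]sqrtr1 ler_wsqrtr // -[leLHS]addr0; apply: lerD; last exact: sqr_ge0.
by rewrite -[leLHS](expr1n _ 2) lerXn2r ?nnegrE ?ler01 //; lra.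
Qed.

Definition kloo_const : R := Num.sqrt (Num.sqrt (2 * q ^ 3 * ndiv q ^ 3)%:R).

Lemma kloo_const_bound (m n : 'I_q) :
  `|kloo (zchar zeta_root) m n| <= (gcdn n q)%:R * kloo_const%:C.
Proof.
have k0 : 0 <= (gcdn n q)%:R * kloo_const%:C.
  by rewrite mulr_ge0 ?ler0n // ler0c sqrtr_ge0.
rewrite -(@ler_pXn2r _ 4) ?nnegrE ?normr_ge0 ?k0 //.
apply: le_trans (kloo_bound_Zp _ _ (zcharD zeta_root_prim) (zcharN zeta_root_prim)
  (zchar_orth zeta_root_prim)) _.
rewrite exprMn -natrX -rmorphXn /=.
have -> : kloo_const ^+ 4 = (2 * q ^ 3 * ndiv q ^ 3)%:R.
  by rewrite /kloo_const (exprM _ 2 2) !sqr_sqrtr ?sqrtr_ge0 // ler0n.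
rewrite rmorph_nat -natrM ler_nat.
(* The fourth root of the gcd is weakened to the gcd itself; summed against 1 / n this costs only a
   factor d(q) H. *)
have : (gcdn n q <= gcdn n q ^ 4)%N.
  by rewrite -[leqLHS]expn1 leq_pexp2l // gcdn_gt0 orbT.
by nia.
Qed.

Lemma inv_count_real X T :
  `|(inv_count p X T)%:R -
    (\sum_(x : 'I_q | (x \is a GRing.unit) && (x <= X)%N) minn q (T - x))%:R / q%:R|
  <= 4 * kloo_const * (ndiv q)%:R * harm R q * (1 + 4 * harm R q).
Proof.
have := inv_count_asymp zeta_root_prim zeta_root_far kloo_const_bound X T.
have -> : harm R[i] q = (harm R q)%:C.
  rewrite /harm rmorph_sum; apply: eq_bigr => k _.
  by rewrite fmorphV rmorph_nat.
set s := (\sum_(x : 'I_q | _) _)%N.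
set a := inv_count p X T; set h := harm R q.
have -> : a%:R - s%:R / q%:R = (a%:R - s%:R / q%:R : R)%:C :> R[i].
  by rewrite rmorphB rmorphM fmorphV !rmorph_nat.
rewrite normc_def /= expr0n addr0 sqrtr_sqr.
have -> : 4 * kloo_const%:C * (ndiv q)%:R * h%:C * (1 + 4 * h%:C) =
  (4 * kloo_const * (ndiv q)%:R * h * (1 + 4 * h))%:C.
  by rewrite !(rmorphM, rmorphD, rmorph1, rmorph_nat).
by rewrite lecR.
Qed.
End ComplexRoot.

(** * The main term *)

Lemma big_multiples (V : nmodType) (F : nat -> V) (e N : nat) : (0 < e)%N ->
  \sum_(1 <= k < N.+1 | (e %| k)%N) F k = \sum_(1 <= k < (N %/ e).+1) F (e * k)%N.
Proof.
move=> e0; rewrite -big_filter -(big_map (fun k => e * k)%N predT F).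
apply/perm_big/uniq_perm; first by rewrite filter_uniq ?iota_uniq.
  rewrite map_inj_uniq ?iota_uniq // => x y /eqP.
  by rewrite eqn_pmul2l // => /eqP.
move=> k; rewrite mem_filter mem_index_iota; apply/idP/mapP.
  case/andP=> /dvdnP[j ->] /andP[k0 kN]; exists j; last by rewrite mulnC.
  rewrite mem_index_iota; move: k0; rewrite muln_gt0 => /andP[-> _] /=.
  by rewrite ltnS leq_divRL // -ltnS.
case=> j; rewrite mem_index_iota => /andP[j0 jN] ->.
by rewrite dvdn_mulr // muln_gt0 e0 j0 /= ltnS mulnC -leq_divRL // -ltnS.
Qed.

(** * The Moebius function *)

Definition moebius (n : nat) : int :=
  \prod_(r <- primes n) (if logn r n == 1 then -1 else 0).

Lemma norm_moebius n : `|moebius n| <= 1.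
Proof.
rewrite /moebius normr_prod; apply: (@le_trans _ _ (\prod_(r <- primes n) (1 : int))).
  by apply: ler_prod => r _; case: ifP.
by rewrite big1.
Qed.

Lemma moebius1 : moebius 1 = 1.
Proof. by rewrite /moebius big_nil. Qed.

Lemma moebius_sq r n : (1 < logn r n)%N -> moebius n = 0.
Proof.
move=> h; have rn : r \in primes n by rewrite -logn_gt0 (ltn_trans _ h).
by rewrite /moebius (big_rem r) //= gtn_eqF // mul0r.
Qed.

Lemma moebiusMprime r n : prime r -> (0 < n)%N -> ~~ (r %| n)%N ->
  moebius (r * n) = - moebius n.
Proof.
move=> r_pr n0 rn; have r0 := prime_gt0 r_pr.
have perm : perm_eq (primes (r * n)) (r :: primes n).
  apply: uniq_perm => [||s]; first exact: primes_uniq.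
    by rewrite /= primes_uniq mem_primes (negbTE rn) !andbF.
  by rewrite primesM // primes_prime // mem_seq1 inE.
rewrite /moebius (perm_big _ perm) big_cons /= lognM // logn_prime // eqxx.
rewrite [logn r n]lognE (negbTE rn) !andbF addn0 eqxx mulN1r; congr (- _).
rewrite big_seq [RHS]big_seq; apply: eq_bigr => s.
rewrite mem_primes => /and3P[s_pr _ sn]; rewrite lognM // logn_prime //.
by case: (eqVneq s r) => [esr|_]; [rewrite -esr sn in rn | rewrite add0n].
Qed.

(** Let r be the least prime factor of n. Divisors divisible by r^2 contribute 0, and those with
    r-exponent 1 are the r e with e a divisor prime to r, so they cancel the terms of the e. *)
Lemma sum_moebius_divisors n : (0 < n)%N ->
  \sum_(e <- divisors n) moebius e = (n == 1%N)%:R.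
Proof.
move=> n0; have [n1|n1] := eqVneq n 1%N.
  by rewrite n1 big_seq1 moebius1.
have r_pr : prime (pdiv n) by rewrite pdiv_prime // ltn_neqAle eq_sym n1.
set r := pdiv n in r_pr; have rn : (r %| n)%N := pdiv_dvd n.
rewrite (bigID (fun e => r %| e)%N) /= -[X in X + _]big_filter -[X in _ + X]big_filter.
set s := [seq e <- divisors n | _]; set t := [seq e <- divisors n | ~~ _].
rewrite (bigID (fun e => logn r e == 1%N)) /= [X in _ + X + _]big1_seq ?addr0; last first.
  move=> e /andP[le]; rewrite mem_filter => /andP[re edn].
  apply: (@moebius_sq r); rewrite ltn_neqAle eq_sym le logn_gt0 mem_primes /=.
  by apply/and3P; split=> //; move: edn; rewrite -dvdn_divisors // => /(dvdn_gt0 n0).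
rewrite -big_filter.
have perm : perm_eq [seq e <- s | logn r e == 1%N] [seq (r * e)%N | e <- t].
  apply: uniq_perm; first by rewrite !filter_uniq ?divisors_uniq.
    rewrite map_inj_uniq ?filter_uniq ?divisors_uniq // => x y /eqP.
    by rewrite eqn_pmul2l ?prime_gt0 // => /eqP.
  move=> e; apply/idP/mapP.
    rewrite !mem_filter -dvdn_divisors // => /and3P[/eqP le re en].
    case/dvdnP: re => d ed; exists d; last by rewrite mulnC.
    have d0 : (0 < d)%N by move: (dvdn_gt0 n0 en); rewrite ed muln_gt0 => /andP[].
    rewrite mem_filter -dvdn_divisors // (dvdn_trans _ en) ?ed ?dvdn_mulr // andbT.
    move: le; rewrite ed lognM ?(prime_gt0 r_pr) ?d0 // (logn_prime _ r_pr) eqxx addn1 => -[].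
    by apply: contra_eqN; rewrite -lt0n logn_gt0 mem_primes r_pr d0.
  case=> d; rewrite mem_filter -dvdn_divisors // => /andP[rd dn] ->.
  have d0 := dvdn_gt0 n0 dn.
  rewrite !mem_filter -/(dvdn r (r * d)) dvdn_mulr // lognM ?(prime_gt0 r_pr) ?d0 // (logn_prime _ r_pr) eqxx /=.
  rewrite [logn r d]lognE (negbTE rd) !andbF /= -dvdn_divisors //.
  by rewrite Gauss_dvd ?rn ?dn // prime_coprime.
rewrite (perm_big _ perm) big_map [X in X + _]big_seq [X in _ + X]big_seq -big_split.
rewrite big1 ?(negbTE n1) // => e; rewrite mem_filter -dvdn_divisors // => /andP[re en].
by rewrite /= (moebiusMprime r_pr (dvdn_gt0 n0 en) re) /= addNr.
Qed.

Lemma sum_moebius n N : (0 < n <= N)%N ->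
  \sum_(1 <= e < N.+1 | (e %| n)%N) moebius e = (n == 1%N)%:R.
Proof.
case/andP=> n0 nN; rewrite -sum_moebius_divisors // -big_filter.
apply/perm_big/uniq_perm; rewrite ?filter_uniq ?iota_uniq ?divisors_uniq // => e.
rewrite mem_filter mem_index_iota -dvdn_divisors //; case: (boolP (e %| n)%N) => //= en.
by rewrite (dvdn_gt0 n0 en) ltnS (leq_trans (dvdn_leq n0 en) nN).
Qed.

Section ConeSum.
Variable R : realType.
Implicit Types (s t u v x y b : R).

(** For u = Q/q - 1 - x/q this is the proportion of y in [1, q] with q + x + y <= Q; see
    [clamp_minn]. *)
Definition clamp u : R := if u <= 0 then 0 else if u <= 1 then u else 1.

Definition clamp_prim u : R :=
  if u <= 0 then 0 else if u <= 1 then u ^+ 2 / 2 else u - 1 / 2.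

Lemma clamp_ge0 u : 0 <= clamp u.
Proof. by rewrite /clamp; case: (leP u 0) => // h1; case: (leP u 1) => // h2; lra. Qed.

Lemma clamp_le1 u : clamp u <= 1.
Proof. by rewrite /clamp; case: (leP u 0) => // h1; case: (leP u 1) => // h2; lra. Qed.

(** [clamp] is nondecreasing with primitive [clamp_prim]; this inequality is what allows Riemann
    sums to be compared without integrals. *)
Lemma clamp_prim_sandwich u v : u <= v ->
  (v - u) * clamp u <= clamp_prim v - clamp_prim u <= (v - u) * clamp v.
Proof.
move=> uv; rewrite /clamp /clamp_prim; apply/andP.
by case: (leP u 0) => h1; case: (leP v 0) => h2; case: (leP u 1) => h3;
  case: (leP v 1) => h4; split; try lra; nra.
Qed.

(** A Riemann sum of step 1 / q. Of the error 2, one unit comes from shifting the monotone sum by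
    one term and one from replacing b q by its integer part [M]. *)
Lemma sum_clamp (c b : R) (q N : nat) : (0 < q)%N -> 0 <= b <= 1 -> (q <= N)%N ->
  let m := \sum_(1 <= x < N.+1 | x%:R <= b * q%:R) clamp (c - x%:R / q%:R) in
  m <= q%:R * (clamp_prim c - clamp_prim (c - b)) <= m + 2.
Proof.
move=> q0 /andP[b0 b1] qN /=; have qR : (0 : R) < q%:R by rewrite ltr0n.
pose M := Num.truncn (b * q%:R).
have /andP[hM1 hM2] : M%:R <= b * q%:R < M.+1%:R.
  by apply: Num.Theory.truncn_itv; rewrite mulr_ge0 // ltW.
have MN : (M <= N)%N.
  apply: leq_trans qN; rewrite -(ler_nat R); apply: le_trans hM1 _.
  by rewrite ler_piMl // ltW.
have -> : \sum_(1 <= x < N.+1 | x%:R <= b * q%:R) clamp (c - x%:R / q%:R) =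
    \sum_(1 <= x < M.+1) clamp (c - x%:R / q%:R).
  rewrite (big_nat_widen 1 M.+1 N.+1) ?ltnS //; apply: eq_bigl => x /=.
  apply/idP/idP => h.
    by rewrite -(ltr_nat R) (le_lt_trans h).
  by rewrite (le_trans _ hM1) // ler_nat -ltnS.
pose g (x : nat) := clamp_prim (c - x%:R / q%:R).
have step (x : nat) :
    clamp (c - x.+1%:R / q%:R) <= q%:R * (g x - g x.+1) <= clamp (c - x%:R / q%:R).
  have e1 : c - x.+1%:R / q%:R <= c - x%:R / q%:R.
    by rewrite lerD2l lerN2 ler_pM2r ?invr_gt0 // ler_nat.
  have := clamp_prim_sandwich e1.
  have -> : c - x%:R / q%:R - (c - x.+1%:R / q%:R) = q%:R^-1 by rewrite -natr1; field; lra.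
  by rewrite ![q%:R^-1 * _]mulrC ler_pdivrMr // ler_pdivlMr // ![_ * q%:R]mulrC.
have tele k : \sum_(0 <= x < k) (q%:R * (g x - g x.+1)) = q%:R * (g 0%N - g k).
  rewrite -mulr_sumr; congr (_ * _); rewrite -[RHS]opprB -telescope_sumr // -sumrN.
  by apply: eq_bigr => x _; rewrite opprB.
have g0 : g 0%N = clamp_prim c by rewrite /g mul0r subr0.
have up : \sum_(1 <= x < M.+1) clamp (c - x%:R / q%:R) <= q%:R * (clamp_prim c - g M).
  by rewrite big_add1 /= -g0 -tele; apply: ler_sum => x _; case/andP: (step x).
have lo : q%:R * (clamp_prim c - g M) <= \sum_(1 <= x < M.+1) clamp (c - x%:R / q%:R) + 1.
  rewrite -g0 -tele; apply: (@le_trans _ _ (\sum_(0 <= x < M.+1) clamp (c - x%:R / q%:R))).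
    rewrite big_nat_recr //= -[leLHS]addr0; apply: lerD; last exact: clamp_ge0.
    by apply: ler_sum => x _; case/andP: (step x).
  by rewrite big_ltn // addrC lerD2l clamp_le1.
have e2 : c - b <= c - M%:R / q%:R by rewrite lerD2l lerN2 ler_pdivrMr.
have /andP[r1 r2] := clamp_prim_sandwich e2.
have h3 : 0 <= g M - clamp_prim (c - b).
  by apply: le_trans r1; rewrite mulr_ge0 ?clamp_ge0 // subr_ge0.
have h4 : q%:R * (g M - clamp_prim (c - b)) <= 1.
  apply: (@le_trans _ _ (q%:R * (b - M%:R / q%:R))).
    rewrite ler_pM2l //; apply: le_trans r2 _.
    have -> : c - M%:R / q%:R - (c - b) = b - M%:R / q%:R by lra.
    by apply: ler_piMr; rewrite ?clamp_le1 // subr_ge0 ler_pdivrMr.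
  have -> : q%:R * (b - M%:R / q%:R) = b * q%:R - M%:R by field; lra.
  by move: hM2; rewrite -natr1; lra.
have h5 : 0 <= q%:R * (g M - clamp_prim (c - b)) by rewrite mulr_ge0 // ltW.
have -> : q%:R * (clamp_prim c - clamp_prim (c - b)) =
  q%:R * (clamp_prim c - g M) + q%:R * (g M - clamp_prim (c - b)) by ring.
apply/andP; split; lra.
Qed.

(* x * clamp_prim (t / x - s), extended by its limit t at x = 0; see coneE. *)
Definition cone s t x : R :=
  if (1 + s) * x <= t then t - (s + 1 / 2) * x
  else if s * x <= t then (t - s * x) ^+ 2 / (2 * x) else 0.

Lemma coneE s t x : 0 < x -> x * clamp_prim (t / x - s) = cone s t x.
Proof.
move=> x0; rewrite /clamp_prim /cone.
have e1 : (t / x - s <= 0) = (t <= s * x) by rewrite subr_le0 ler_pdivrMr.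
have e2 : (t / x - s <= 1) = (t <= (1 + s) * x).
  by rewrite lerBlDr ler_pdivrMr.
rewrite e1 e2; case: (leP t (s * x)) => h1.
  case: leP => h2; first by nra.
  case: leP => h3; last by rewrite mulr0.
  have -> : t = s * x by lra.
  by rewrite subrr expr0n mul0r mulr0.
case: (leP ((1 + s) * x) t) => h2.
  case: leP => h3; last by field; lra.
  have -> : t = (1 + s) * x by lra.
  by field; lra.
by rewrite (ltW h2) (ltW h1); field; lra.
Qed.

(* The primitive of cone that vanishes at 0. *)
Definition cone_prim s t x : R :=
  if (1 + s) * x <= t then t * x - (s + 1 / 2) * x ^+ 2 / 2
  else if s * x <= t then
    t ^+ 2 / 2 * ln ((1 + s) * x / t) - s * t * x + s ^+ 2 * x ^+ 2 / 4 + t ^+ 2 * (3 / 4)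
  else t ^+ 2 / 2 * ln ((1 + s) / s).

End ConeSum.

Lemma cone_ge0 (R : realType) (s t x : R) :
  0 <= x -> 0 <= cone s t x.
Proof.
move=> x0; rewrite /cone; case: (leP ((1 + s) * x) t) => h1; first by nra.
by case: (leP (s * x) t) => // h2; rewrite divr_ge0 ?sqr_ge0 //; lra.
Qed.

Lemma cone_le (R : realType) (s t x y : R) (s1 : 1 <= s) (t0 : 0 < t) :
  0 <= x -> x <= y -> cone s t y <= cone s t x.
Proof.
move=> x0 xy; have k0 := cone_ge0 s t x0; move: k0; rewrite /cone.
have sxy : s * x <= s * y by rewrite ler_wpM2l //; lra.
case: (leP ((1 + s) * y) t) => y1.
  case: (leP ((1 + s) * x) t) => x1 _; [lra | exfalso; lra].
case: (leP (s * y) t) => // y2.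
have sx : s * x <= t by lra.
have y0 : 0 < y.
  by rewrite -(pmulr_rgt0 y (_ : 0 < 1 + s)); lra.
case: (leP ((1 + s) * x) t) => x1; last first.
  rewrite sx => _; have x2 : 0 < x by nra.
  apply: (@le_trans _ _ ((t - s * x) ^+ 2 / (2 * y))).
    rewrite ler_pM2r ?invr_gt0; last lra.
    have w1 : 0 <= t - s * y by lra.
    have w2 : t - s * y <= t - s * x by nra.
    by nra.
  rewrite ler_wpM2l ?sqr_ge0 // lef_pV2 ?posrE; lra.
move=> _; rewrite ler_pdivrMr; last lra.
(* At the break point a both formulas for [cone] equal a / 2, which separates the value at y from
   the value at x. *)
pose a := t / (1 + s); have ea : t = (1 + s) * a by rewrite /a mulrC mulfVK //; lra.
have ay : a <= y by nra.
have xa : x <= a by nra.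
have w0 : 0 <= t - s * y by lra.
have wa : t - s * y <= a by nra.
have wy : (t - s * y) ^+ 2 <= a * y by nra.
have ka : a / 2 <= t - (s + 1 / 2) * x by nra.
by nra.
Qed.

(* The slack (y - x)^2 lets first-order bounds on ln replace the mean value
   theorem; being superadditive, it survives concatenation of intervals. *)
Definition sandwiched (R : realType) (s t x y : R) :=
  (y - x) * cone s t y - (y - x) ^+ 2 <= cone_prim s t y - cone_prim s t x
    <= (y - x) * cone s t x + (y - x) ^+ 2.

Lemma sandwiched_cat (R : realType) (s t x m y : R) (s1 : 1 <= s) (t0 : 0 < t) :
  0 <= x -> x <= m -> m <= y ->
  sandwiched s t x m -> sandwiched s t m y -> sandwiched s t x y.
Proof.
move=> x0 xm my /andP[h1 h2] /andP[h3 h4].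
have k1 := cone_le s1 t0 x0 xm; have k2 := cone_le s1 t0 (le_trans x0 xm) my.
have e1 : 0 <= (m - x) * (cone s t m - cone s t y) by rewrite mulr_ge0; lra.
have e2 : 0 <= (y - m) * (cone s t x - cone s t m) by rewrite mulr_ge0; lra.
have e3 : 0 <= (m - x) * (y - m) by rewrite mulr_ge0; lra.
by apply/andP; split; nra.
Qed.

Lemma sandwiched1 (R : realType) (s t x y : R) (s1 : 1 <= s) (t0 : 0 < t) :
  0 <= x -> x <= y -> (1 + s) * y <= t -> sandwiched s t x y.
Proof.
move=> x0 xy y1; have x1 : (1 + s) * x <= t by nra.
have e1 : 0 <= (s + 1 / 2) * (y - x) ^+ 2 by rewrite mulr_ge0 ?sqr_ge0 //; lra.
have e2 := sqr_ge0 (y - x).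
by rewrite /sandwiched /cone /cone_prim x1 y1; apply/andP; split; lra.
Qed.

Lemma cone2 (R : realType) (s t x : R) (s1 : 1 <= s) (t0 : 0 < t) :
  t <= (1 + s) * x -> s * x <= t -> cone s t x = (t - s * x) ^+ 2 / (2 * x).
Proof.
move=> h1 h2; rewrite /cone h2; case: (leP ((1 + s) * x) t) => // h3.
have -> : t = (1 + s) * x by lra.
field; nra.
Qed.

Lemma cone_prim2 (R : realType) (s t x : R) (s1 : 1 <= s) (t0 : 0 < t) :
  t <= (1 + s) * x -> s * x <= t -> cone_prim s t x =
  t ^+ 2 / 2 * ln ((1 + s) * x / t) - s * t * x + s ^+ 2 * x ^+ 2 / 4 + t ^+ 2 * (3 / 4).
Proof.
move=> h1 h2; rewrite /cone_prim h2; case: (leP ((1 + s) * x) t) => // h3.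
have -> : (1 + s) * x = t by lra.
rewrite divff ?gt_eqF // ln1 mulr0.
have -> : t = (1 + s) * x by lra.
by field.
Qed.

(** With (y - x)/y <= ln (y/x) <= (y - x)/x the logarithmic terms match, and what remains is s^2 (y
    - x)^2 / 4, within the slack because s <= 2. *)
Lemma sandwiched2 (R : realType) (s t x y : R) (s1 : 1 <= s) (s2 : s <= 2) (t0 : 0 < t) :
  t <= (1 + s) * x -> x <= y -> s * y <= t -> sandwiched s t x y.
Proof.
move=> x1 xy y2; have x0 : 0 < x by nra.
have y0 : 0 < y by lra.
have y1 : t <= (1 + s) * y by nra.
have x2 : s * x <= t by nra.
rewrite /sandwiched !cone2 // !cone_prim2 //.
have ln_yx : ln ((1 + s) * y / t) = ln ((1 + s) * x / t) + ln (y / x).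
  rewrite -lnM ?posrE ?mulr_gt0 ?invr_gt0 //; try lra.
  by congr ln; field; lra.
have up : ln (y / x) <= (y - x) / x.
  have -> : y / x = 1 + (y - x) / x by field; lra.
  apply: le_ln1Dx; apply: (@lt_le_trans _ _ 0); first lra.
  by rewrite divr_ge0; lra.
have lo : (y - x) / y <= ln (y / x).
  rewrite -[leRHS]opprK -lnV ?posrE ?divr_gt0 // invf_div lerNr.
  have -> : x / y = 1 + (x - y) / y by field; lra.
  have -> : - ((y - x) / y) = (x - y) / y by field; lra.
  apply: le_ln1Dx; rewrite ltr_pdivlMr; lra.
have up' : t ^+ 2 / 2 * ln (y / x) <= t ^+ 2 / 2 * ((y - x) / x) by rewrite ler_pM2l //; nra.
have lo' : t ^+ 2 / 2 * ((y - x) / y) <= t ^+ 2 / 2 * ln (y / x) by rewrite ler_pM2l //; nra.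
have e1 : s ^+ 2 * (y - x) ^+ 2 <= 4 * (y - x) ^+ 2 by rewrite ler_wpM2r ?sqr_ge0 //; nra.
rewrite ln_yx mulrDr; apply/andP; split.
  have -> : (y - x) * ((t - s * y) ^+ 2 / (2 * y)) = t ^+ 2 / 2 * ((y - x) / y)
    - (y - x) * s * t + (y - x) * s ^+ 2 * y / 2 by field; lra.
  move: lo'; move: (t ^+ 2 / 2 * ((y - x) / y)) (t ^+ 2 / 2 * ln (y / x)) => A B AB.
  by lra.
have -> : (y - x) * ((t - s * x) ^+ 2 / (2 * x)) = t ^+ 2 / 2 * ((y - x) / x)
    - (y - x) * s * t + (y - x) * s ^+ 2 * x / 2 by field; lra.
move: up'; move: (t ^+ 2 / 2 * ((y - x) / x)) (t ^+ 2 / 2 * ln (y / x)) => A B AB.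
by lra.
Qed.

Lemma cone_prim3 (R : realType) (s t x : R) (s1 : 1 <= s) (t0 : 0 < t) :
  t <= s * x -> cone_prim s t x = t ^+ 2 / 2 * ln ((1 + s) / s).
Proof.
move=> h1; rewrite /cone_prim; case: (leP ((1 + s) * x) t) => h2; first by nra.
case: (leP (s * x) t) => // h3; have -> : t = s * x by lra.
have -> : (1 + s) * x / (s * x) = (1 + s) / s by field; nra.
by field.
Qed.

Lemma sandwiched3 (R : realType) (s t x y : R) (s1 : 1 <= s) (t0 : 0 < t) :
  t <= s * x -> x <= y -> sandwiched s t x y.
Proof.
move=> x1 xy; have y1 : t <= s * y by nra.
have k0 (u : R) : t <= s * u -> cone s t u = 0.
  move=> h1; rewrite /cone; case: (leP ((1 + s) * u) t) => h2; first by nra.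
  case: (leP (s * u) t) => // h3; have -> : t = s * u by lra.
  by rewrite subrr expr0n mul0r.
by rewrite /sandwiched !cone_prim3 // !k0 // !mulr0 subrr; nra.
Qed.

(** The interval is cut at t / (1 + s) and t / s, where the formula for [cone] changes, and the
    pieces are concatenated. *)
Lemma cone_sandwich (R : realType) (s t x y : R) (s1 : 1 <= s) (s2 : s <= 2) (t0 : 0 < t) :
  0 <= x -> x <= y -> sandwiched s t x y.
Proof.
move=> x0 xy; pose a := t / (1 + s); pose b := t / s.
have s0 : 0 < s by lra.
have ea : (1 + s) * a = t by rewrite /a mulrC mulfVK //; lra.
have eb : s * b = t by rewrite /b mulrC mulfVK //; lra.
have ab : a <= b by nra.
have a0 : 0 <= a by nra.
have below z : z <= a -> (1 + s) * z <= t by nra.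
have above z : a <= z -> t <= (1 + s) * z by nra.
have belowb z : z <= b -> s * z <= t by nra.
have aboveb z : b <= z -> t <= s * z by nra.
have s12 u v : a <= u -> u <= v -> sandwiched s t u v.
  move=> au uv; have [vb|vb] := leP v b; first by apply: sandwiched2; auto.
  have [ub|ub] := leP u b; last by apply: sandwiched3; auto; apply: aboveb; lra.
  apply: (@sandwiched_cat _ s t u b v s1 t0); try lra.
    by apply: sandwiched2; auto.
  by apply: sandwiched3; auto; lra.
have [ya|ya] := leP y a; first by apply: sandwiched1; auto.
have [xa|xa] := leP x a; last by apply: s12; lra.
apply: (@sandwiched_cat _ s t x a y s1 t0); try lra; first by apply: sandwiched1; auto.
by apply: s12; lra.
Qed.

(** Unit steps telescope against [cone_prim]: the slack costs 1 per step, at most N <= t in all, and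
    the end terms at most t + 1. *)
Lemma sum_cone (R : realType) (s t : R) (s1 : 1 <= s) (s2 : s <= 2) (t0 : 0 < t) (N : nat) :
  N%:R <= t -> t < N.+1%:R -> 1 <= t ->
  `|\sum_(1 <= q < N.+1) cone s t q%:R - t ^+ 2 / 2 * ln ((1 + s) / s)| <= 3 * t.
Proof.
move=> Nt tN t1; set c := t ^+ 2 / 2 * _.
(* Since N + 1 > t and s >= 1, the point N + 1 is past t / s, where [cone_prim] is constant. *)
have cE : cone_prim s t N.+1%:R = c.
  apply: cone_prim3 => //; apply: (le_trans (ltW tN)).
  by rewrite ler_peMl ?ler0n.
have K0 : cone_prim s t 0 = 0 by rewrite /cone_prim mulr0 (ltW t0); ring.
have step (q : nat) :
    cone s t q.+1%:R - 1 <= cone_prim s t q.+1%:R - cone_prim s t q%:R <= cone s t q%:R + 1.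
  have := cone_sandwich s1 s2 t0 (ler0n R q) (_ : q%:R <= q.+1%:R).
  rewrite ler_nat => /(_ (leqnSn q)); rewrite /sandwiched -natr1.
  rewrite (_ : q%:R + 1 - q%:R = 1); last by ring.
  by rewrite expr1n !mul1r.
have tele m n : (m <= n)%N ->
    \sum_(m <= q < n) (cone_prim s t q.+1%:R - cone_prim s t q%:R) =
    cone_prim s t n%:R - cone_prim s t m%:R.
  by move=> mn; rewrite (telescope_sumr (fun q => cone_prim s t q%:R)).
have up : \sum_(1 <= q < N.+1) cone s t q%:R <= cone_prim s t N%:R + N%:R.
  have -> : cone_prim s t N%:R + N%:R =
      \sum_(0 <= q < N) (cone_prim s t q.+1%:R - cone_prim s t q%:R + 1).
    by rewrite big_split /= tele // K0 subr0 sumr_const_nat subn0.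
  by rewrite big_add1 /=; apply: ler_sum => q _; case/andP: (step q); lra.
have lo : cone_prim s t N.+1%:R - cone_prim s t 1%:R <= \sum_(1 <= q < N.+1) cone s t q%:R + N%:R.
  rewrite -tele //; apply: (@le_trans _ _ (\sum_(1 <= q < N.+1) (cone s t q%:R + 1))).
    by apply: ler_sum => q _; case/andP: (step q).
  by rewrite big_split /= sumr_const_nat subSS subn0.
have k0 : cone s t 0 = t by rewrite /cone mulr0 (ltW t0); ring.
have [s01 s02] := andP (step 0%N); rewrite K0 k0 in s02.
have [sN1 sN2] := andP (step N).
have kN := cone_ge0 s t (ler0n R N.+1).
by rewrite ler_norml; apply/andP; split; lra.
Qed.

(** By [sum_clamp] and [coneE] the inner sum is [cone 1 - cone (1 + b)] up to 2, and the limits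
    combine as ln 2 - ln((2 + b)/(1 + b)). The errors are 3t, 3t and 2N <= 2t. *)
Lemma sum_clamp_cone (R : realType) (b t : R) (N : nat) :
  0 <= b <= 1 -> N%:R <= t -> t < N.+1%:R -> 1 <= t ->
  `|\sum_(1 <= q < N.+1) \sum_(1 <= x < N.+1 | x%:R <= b * q%:R)
      clamp (t / q%:R - 1 - x%:R / q%:R)
    - t ^+ 2 / 2 * ln (2 * (1 + b) / (2 + b))| <= 8 * t.
Proof.
move=> /[dup] b01 /andP[b0 b1] Nt tN t1; have t0 : 0 < t by lra.
set W := \sum_(1 <= q < _) _.
have h1 := sum_cone (lexx 1) (_ : 1 <= 2) t0 Nt tN t1.
have {}h1 := h1 (ler1n _ 2).
have s1 : 1 <= 1 + b by lra.
have s2 : 1 + b <= 2 by lra.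
have h2 := sum_cone s1 s2 t0 Nt tN t1.
set A := \sum_(1 <= q < _) _ in h1; set B := \sum_(1 <= q < _) _ in h2.
have hW : W <= A - B <= W + 2 * N%:R.
  have step q : (0 < q)%N -> (q <= N)%N ->
    \sum_(1 <= x < N.+1 | x%:R <= b * q%:R) clamp (t / q%:R - 1 - x%:R / q%:R)
     <= cone 1 t q%:R - cone (1 + b) t q%:R <=
    \sum_(1 <= x < N.+1 | x%:R <= b * q%:R) clamp (t / q%:R - 1 - x%:R / q%:R) + 2.
    move=> q0 qN; rewrite -!coneE ?ltr0n // -mulrBr opprD addrA.
    exact: sum_clamp.
  have -> : W + 2 * N%:R = \sum_(1 <= q < N.+1) (\sum_(1 <= x < N.+1 | x%:R <= b * q%:R)
      clamp (t / q%:R - 1 - x%:R / q%:R) + 2).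
    by rewrite big_split /= sumr_const_nat subSS subn0 mulr_natr.
  rewrite /A /B /W -sumrB; apply/andP; split; rewrite [leLHS]big_nat [leRHS]big_nat;
    apply: ler_sum => q /andP[q0 qN]; by case/andP: (step q q0 qN).
have -> : ln (2 * (1 + b) / (2 + b)) = ln ((1 + 1) / 1) - ln ((1 + (1 + b)) / (1 + b)).
  by rewrite -ln_div ?posrE ?divr_gt0 //; try lra; congr ln; field; lra.
move: h1 h2; rewrite !ler_norml mulrBr => /andP[h1 h1'] /andP[h2 h2'].
by case/andP: hW => h3 h4; apply/andP; split; lra.
Qed.

(** Since the summand depends only on ratios, writing q and x as multiples of e replaces Q by Q / e
    inside it and the ranges by the integer part of Q / e. *)
Lemma sum_clamp_coprime (R : realType) (b : R) (Q : nat) :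
  \sum_(1 <= q < Q.+1) \sum_(1 <= x < Q.+1 | (x%:R <= b * q%:R) && coprime q x)
      clamp (R := R) (Q%:R / q%:R - 1 - x%:R / q%:R) =
  \sum_(1 <= e < Q.+1) (moebius e)%:~R *
    \sum_(1 <= q < (Q %/ e).+1) \sum_(1 <= x < (Q %/ e).+1 | x%:R <= b * q%:R)
      clamp (R := R) (Q%:R / e%:R / q%:R - 1 - x%:R / q%:R).
Proof.
pose f (q x : nat) : R := if x%:R <= b * q%:R
  then clamp (R := R) (Q%:R / q%:R - 1 - x%:R / q%:R) else 0.
transitivity (\sum_(1 <= q < Q.+1) \sum_(1 <= x < Q.+1) \sum_(1 <= e < Q.+1)
    (if (e %| q)%N then if (e %| x)%N then (moebius e)%:~R * f q x else 0 else 0)).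
  rewrite big_nat [RHS]big_nat; apply: eq_bigr => q /andP[q0 qQ].
  rewrite big_mkcond big_nat [RHS]big_nat; apply: eq_bigr => x /andP[x0 xQ].
  have g0 : (0 < gcdn q x <= Q)%N.
    by rewrite gcdn_gt0 q0 /= (leq_trans (dvdn_leq q0 (dvdn_gcdl q x))).
  transitivity ((\sum_(1 <= e < Q.+1 | (e %| gcdn q x)%N) moebius e)%:~R * f q x).
    rewrite sum_moebius // /f /coprime; case: (x%:R <= b * q%:R) => /=; rewrite ?mulr0 //.
    by case: eqP => _; rewrite ?mul1r ?mul0r.
  rewrite rmorph_sum mulr_suml big_mkcond /=; apply: eq_bigr => e _.
  by rewrite dvdn_gcd; case: (e %| q)%N; case: (e %| x)%N.
under eq_bigr do rewrite exchange_big /=.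
rewrite exchange_big /= big_nat [RHS]big_nat; apply: eq_bigr => e /andP[e0 eQ].
transitivity (\sum_(1 <= q < Q.+1 | (e %| q)%N) \sum_(1 <= x < Q.+1 | (e %| x)%N)
   (moebius e)%:~R * f q x).
  rewrite [RHS]big_mkcond; apply: eq_bigr => q _; case: ifP => _.
    by rewrite [RHS]big_mkcond.
  by rewrite big1.
rewrite big_multiples // mulr_sumr big_nat [RHS]big_nat; apply: eq_bigr => q /andP[q0 _].
rewrite big_multiples // -mulr_sumr; congr (_ * _); rewrite [RHS]big_mkcond.
have eR : (0 : R) < e%:R by rewrite ltr0n.
have qR : (0 : R) < q%:R by rewrite ltr0n.
apply: eq_bigr => x _; rewrite /f !natrM mulrCA ler_pM2l //.
case: ifP => // _; congr clamp; field; lra.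
Qed.

(** * Partial sums for zeta(2) and its inverse *)

(** A finite form of the identity zeta(2) times the sum of mu(e)/e^2 is 1: grouping by n = e k <= N
    leaves only n = 1. *)
Lemma moebius_zeta_partial (F : numFieldType) (N : nat) : (0 < N)%N ->
  \sum_(1 <= e < N.+1) (moebius e)%:~R / e%:R ^+ 2 *
     \sum_(1 <= k < (N %/ e).+1) (k%:R ^+ 2)^-1 = 1 :> F.
Proof.
move=> N0; transitivity (\sum_(1 <= e < N.+1) \sum_(1 <= n < N.+1 | (e %| n)%N)
   (moebius e)%:~R * (n%:R ^+ 2)^-1 : F).
  rewrite big_nat [RHS]big_nat; apply: eq_bigr => e /andP[e0 _].
  rewrite big_multiples // mulr_sumr; apply: eq_bigr => k _.
  by rewrite natrM exprMn [(_ * _ ^+ 2)^-1]invfM mulrA.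
transitivity (\sum_(1 <= n < N.+1) (\sum_(1 <= e < N.+1 | (e %| n)%N) moebius e)%:~R
   * (n%:R ^+ 2)^-1 : F).
  under eq_bigr => e _ do rewrite big_mkcond /=.
  rewrite exchange_big /=; apply: eq_bigr => n _.
  by rewrite -big_mkcond rmorph_sum mulr_suml.
rewrite big_ltn // sum_moebius // expr1n invr1 mulr1 big_nat big1 ?addr0 // => n /andP[n1 nN].
by rewrite sum_moebius ?(ltn_trans _ n1) //= gtn_eqF // mul0r.
Qed.

(** The tail is compared with a telescoping series through 1/(m + 1)^2 <= 1/m - 1/(m + 1). *)
Lemma zeta2_partial (R : realType) (k : nat) : (0 < k)%N ->
  0 <= zeta (2 : R) - \sum_(1 <= n < k.+1) (n%:R ^+ 2)^-1 <= k%:R^-1.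
Proof.
move=> k0; pose u := series (riemannR (2 : R)).
have uE n : u n = \sum_(1 <= i < n.+1) (i%:R ^+ 2)^-1.
  by rewrite /u /series /= big_add1; apply: eq_bigr => i _; rewrite /riemannR powR_mulrn ?ler0n.
have u_homo : {homo u : n m / (n <= m)%N >-> n <= m}.
  move=> n m nm; rewrite !uE [leRHS](@big_cat_nat _ _ _ n.+1) //= lerDl.
  by apply: sumr_ge0 => i _; rewrite invr_ge0 exprn_ge0.
have u_tail n m : (0 < n)%N -> (n <= m)%N -> u m <= u n + n%:R^-1 - m%:R^-1.
  move=> n0; elim: m => [|m IHm]; first by rewrite leqn0 => /eqP n0'; rewrite n0' in n0.
  rewrite leq_eqVlt => /predU1P[<-|]; first by rewrite addrK.
  rewrite ltnS => nm; have m0 : (0 : R) < m%:R by rewrite ltr0n (leq_trans n0).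
  rewrite uE big_nat_recr //= -uE.
  suff : (m.+1%:R ^+ 2)^-1 <= m%:R^-1 - m.+1%:R^-1 :> R.
    move: (IHm nm) => h1 h2; apply: le_trans (lerD h1 h2) _.
    by rewrite addrA subrK.
  have -> : m%:R^-1 - m.+1%:R^-1 = (m%:R * m.+1%:R)^-1 :> R by rewrite -natr1; field; lra.
  rewrite lef_pV2 ?posrE ?exprn_gt0 ?mulr_gt0 ?ltr0n //; last by rewrite -(ltr0n R).
  by rewrite expr2 ler_pM2r ?ltr0n // ler_nat.
have u_le n : u n <= u k + k%:R^-1.
  have [kn|nk] := leqP k n.
    apply: le_trans (u_tail _ _ k0 kn) _.
    by rewrite lerBlDr lerDl invr_ge0.
  by apply: le_trans (u_homo _ _ (ltnW nk)) _; rewrite lerDl invr_ge0.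
have u_cvg : cvgn u.
  apply: nondecreasing_is_cvgn => //; exists (u k + k%:R^-1) => _ [n _ <-].
  exact: u_le.
rewrite -uE subr_ge0 nondecreasing_cvgn_le //= lerBlDl.
by apply: limr_le => //; apply: nearW => n; exact: u_le.
Qed.

Lemma zeta2_ge1 (R : realType) : 1 <= zeta (2 : R).
Proof.
have /andP[+ _] := zeta2_partial R (ltn0Sn 0).
by rewrite big_nat1 expr1n invr1 subr_ge0.
Qed.

(** After multiplication by zeta(2) >= 1 and subtraction of [moebius_zeta_partial], each e is left
    with a tail of zeta(2) beyond N / e, weighted by at most 1 / e^2. *)
Lemma zeta2_moebius (R : realType) (N : nat) : (0 < N)%N ->
  `|\sum_(1 <= e < N.+1) (moebius e)%:~R / e%:R ^+ 2 - (zeta (2 : R))^-1|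
   <= 2 * harm R N.+1 / N%:R.
Proof.
move=> N0; have z1 := zeta2_ge1 R; have NR : (0 : R) < N%:R by rewrite ltr0n.
set S := \sum_(1 <= e < _) _.
have -> : S - (zeta (2 : R))^-1 = (zeta 2 * S - 1) / zeta 2 by field; lra.
rewrite normrM normfV [ `|zeta 2|]ger0_norm; last by lra.
rewrite ler_pdivrMr; last by lra.
apply: (@le_trans _ _ (2 * harm R N.+1 / N%:R)); last first.
  by rewrite ler_peMr // !mulr_ge0 ?invr_ge0 ?ler0n // sumr_ge0 // => i _; rewrite invr_ge0.
rewrite -[X in _ - X](moebius_zeta_partial R N0) mulr_sumr -sumrB.
apply: le_trans (ler_norm_sum _ _ _) _.
rewrite /harm mulr_sumr mulr_suml [leLHS]big_nat [leRHS]big_nat.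
apply: ler_sum => e /andP[e0 eN].
have eR : (0 : R) < e%:R by rewrite ltr0n.
have k0 : (0 < N %/ e)%N by rewrite divn_gt0.
have /andP[d0 d1] := zeta2_partial R k0.
rewrite [zeta 2 * _]mulrC -mulrBr normrM [ `|_ - _|]ger0_norm //.
have mu1 : `|(moebius e)%:~R / e%:R ^+ 2| <= (e%:R ^+ 2)^-1 :> R.
  rewrite normrM [ `|_^-1|]ger0_norm ?invr_ge0 ?exprn_ge0 //.
  rewrite ler_piMl ?invr_ge0 ?exprn_ge0 //.
  by rewrite -intr_norm -[leRHS]/(1%:~R) ler_int norm_moebius.
apply: (@le_trans _ _ ((e%:R ^+ 2)^-1 * (N %/ e)%:R^-1)).
  by apply: ler_pM.
(* For e <= N, rounding N / e down loses at most a factor 2. *)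
have h : N%:R <= 2 * e%:R * (N %/ e)%:R :> R.
  rewrite -!natrM ler_nat; have := ltn_ceil N e0; move: k0 e0; nia.
have k0R : (0 : R) < (N %/ e)%:R by rewrite ltr0n.
have -> : 2 * e%:R^-1 / N%:R = (e%:R * N%:R / 2)^-1 :> R by field; lra.
rewrite -invfM lef_pV2 ?posrE ?divr_gt0 ?mulr_gt0 ?exprn_gt0 //.
by rewrite ler_pdivrMr //; nra.
Qed.

Lemma ln_cone_bound (R : realType) (b : R) : 0 <= b <= 1 ->
  0 <= ln (2 * (1 + b) / (2 + b)) <= 1.
Proof.
case/andP=> b0 b1; apply/andP; split.
  by apply: ln_ge0; rewrite ler_pdivlMr; lra.
have -> : 2 * (1 + b) / (2 + b) = 1 + b / (2 + b) by field; lra.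
apply: le_trans (le_ln1Dx _) _.
  by apply: (@lt_le_trans _ _ 0); rewrite ?ltrN10 // divr_ge0; lra.
by rewrite ler_pdivrMr; lra.
Qed.

(** The errors 8 Q / e of [sum_clamp_cone] add up to 8 Q H_Q; replacing the partial Moebius sum by 1
    / zeta(2) costs another Q H_Q, as the logarithm is at most 1. *)
Lemma sum_clamp_coprime_asymp (R : realType) (b : R) (Q : nat) :
  (0 < Q)%N -> 0 <= b <= 1 ->
  `|\sum_(1 <= q < Q.+1) \sum_(1 <= x < Q.+1 | (x%:R <= b * q%:R) && coprime q x)
      clamp (R := R) (Q%:R / q%:R - 1 - x%:R / q%:R)
    - Q%:R ^+ 2 / (2 * zeta (2 : R)) * ln (2 * (1 + b) / (2 + b))|
  <= 9 * Q%:R * harm R Q.+1.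
Proof.
move=> Q0 b01; have z1 := zeta2_ge1 R; have QR : (0 : R) < Q%:R by rewrite ltr0n.
rewrite sum_clamp_coprime; set L := ln _.
have /andP[L0 L1] : 0 <= L <= 1 by exact: ln_cone_bound.
have H0 : 0 <= harm R Q.+1 by rewrite sumr_ge0 // => i _; rewrite invr_ge0.
set S := \sum_(1 <= e < _) _; pose m := \sum_(1 <= e < Q.+1) (moebius e)%:~R / e%:R ^+ 2 : R.
have -> : S - Q%:R ^+ 2 / (2 * zeta (2 : R)) * L =
  (S - Q%:R ^+ 2 / 2 * L * m) + Q%:R ^+ 2 / 2 * L * (m - (zeta 2)^-1) by field; lra.
have -> : 9 * Q%:R * harm R Q.+1 = 8 * Q%:R * harm R Q.+1 + Q%:R * harm R Q.+1 by ring.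
apply: le_trans (ler_normD _ _) _; apply: lerD.
  rewrite /S /m mulr_sumr -sumrB; apply: le_trans (ler_norm_sum _ _ _) _.
  rewrite /harm mulr_sumr [leLHS]big_nat [leRHS]big_nat; apply: ler_sum => e /andP[e0 eQ].
  have eR : (0 : R) < e%:R by rewrite ltr0n.
  rewrite [X in _ - X](_ : _ = (moebius e)%:~R * ((Q%:R / e%:R) ^+ 2 / 2 * L)); last first.
    by field; lra.
  rewrite -mulrBr normrM.
  apply: (@le_trans _ _ (1 * (8 * (Q%:R / e%:R)))); last by rewrite mul1r mulrA.
  apply: ler_pM => //.
    by rewrite -intr_norm -[leRHS]/(1%:~R) ler_int norm_moebius.
  apply: sum_clamp_cone => //.
  - by rewrite ler_pdivlMr // -natrM ler_nat leq_divM.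
  - by rewrite ltr_pdivrMr // -natrM ltr_nat ltn_ceil.
  - by rewrite ler_pdivlMr // mul1r ler_nat.
rewrite normrM ger0_norm; last by rewrite !mulr_ge0 ?invr_ge0 ?exprn_ge0 ?ler0n.
apply: (@le_trans _ _ (Q%:R ^+ 2 / 2 * 1 * (2 * harm R Q.+1 / Q%:R))).
  apply: ler_pM => //; last exact: zeta2_moebius.
    by rewrite !mulr_ge0 ?invr_ge0 ?exprn_ge0 ?ler0n.
  by rewrite ler_wpM2l // mulr_ge0 ?invr_ge0 ?exprn_ge0 ?ler0n.
by rewrite le_eqVlt; apply/orP; left; apply/eqP; field; lra.
Qed.

(** * Divisor and harmonic bounds *)

(** A divisor e is r^i times e / r^i, where r^i = gcd(e, r^k), and the cofactor divides m. *)
Lemma ndiv_pfactor r k m : prime r -> (0 < m)%N ->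
  (ndiv (r ^ k * m) <= k.+1 * ndiv m)%N.
Proof.
move=> r_pr m0; have r0 := prime_gt0 r_pr.
have n0 : (0 < r ^ k * m)%N by rewrite muln_gt0 expn_gt0 r0.
rewrite -(size_iota 0 k.+1) /ndiv -(size_allpairs (fun i d => r ^ i * d)%N).
apply: uniq_leq_size; first exact: divisors_uniq.
move=> e; rewrite -dvdn_divisors // => en.
have e0 := dvdn_gt0 n0 en.
pose g := gcdn e (r ^ k).
have : (g %| r ^ k)%N by exact: dvdn_gcdr.
case/(dvdn_pfactor _ _ r_pr) => i ik gE.
apply/allpairsP; exists (i, e %/ g)%N; split; [by rewrite mem_iota | rewrite [_.2]/= | rewrite [_.1]/= [_.2]/=].
  have g0 : (0 < g)%N by rewrite gcdn_gt0 e0.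
  rewrite -dvdn_divisors // -(@Gauss_dvdr _ (r ^ k %/ g)); last first.
    rewrite /coprime -(eqn_pmul2l g0) muln_gcdr !(mulnC g) !divnK ?dvdn_gcdl ?dvdn_gcdr //.
    by rewrite mul1n.
  rewrite -(dvdn_pmul2r g0) divnK ?dvdn_gcdl // mulnAC divnK ?dvdn_gcdr //.
by rewrite -gE mulnC divnK // dvdn_gcdl.
Qed.

(** With f the integer part of k / j, k + 1 <= j (f + 1) <= j 2^f, and this is raised to the power
    j. *)
Lemma leq_expS_pow2 j k : (0 < j)%N -> (k.+1 ^ j <= j ^ j * 2 ^ k)%N.
Proof.
move=> j0; apply: (@leq_trans ((j * 2 ^ (k %/ j)) ^ j)).
  rewrite leq_exp2r // (leq_trans (ltn_ceil k j0)) // mulnC leq_mul2l.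
  by rewrite ltn_expl // orbT.
rewrite expnMn -expnM leq_mul2l leq_exp2l // leq_divM orbT //.
Qed.

(* Only primes r < 2^j can contribute a factor (k+1)^j > r^k. *)
Lemma ndiv_exp_bound j n : (0 < j)%N -> (0 < n)%N ->
  (ndiv n ^ j <= (j ^ j) ^ (2 ^ j) * n)%N.
Proof.
move=> j0; set B := (2 ^ j)%N; set c := (j ^ j)%N.
have c0 : (0 < c)%N by rewrite expn_gt0 j0.
pose cnt n := count (fun r => r < B)%N (primes n).
have cntB m : (cnt m <= B)%N.
  rewrite /cnt -size_filter -[leqRHS](size_iota 0) uniq_leq_size ?filter_uniq ?primes_uniq //.
  by move=> r; rewrite mem_filter mem_iota => /andP[].
move=> n0; apply: (@leq_trans (c ^ cnt n * n)); last first.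
  by rewrite leq_mul2r leq_pexp2l ?orbT.
elim/ltn_ind: n n0 => n IHn n0.
have [n1|n1] := leqP n 1.
  have -> : n = 1%N by lia.
  by rewrite /ndiv /= exp1n.
(* The induction removes the full power r^k of the least prime factor; it costs a factor c only when
   r < 2^j. *)
have r_pr := pdiv_prime n1; set r := pdiv n in r_pr.
have [m rm nE] := pfactor_coprime r_pr n0.
have k0 : (0 < logn r n)%N by rewrite logn_gt0 mem_primes r_pr n0 pdiv_dvd.
set k := logn r n in nE k0.
have r1 := prime_gt1 r_pr.
have m0 : (0 < m)%N by move: n0; rewrite nE muln_gt0 => /andP[].
have rk1 : (1 < r ^ k)%N by rewrite -(expn0 r) ltn_exp2l.
have mn : (m < n)%N by rewrite nE -[ltnLHS]muln1 ltn_mul2l m0.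
have cntE : cnt n = ((r < B) + cnt m)%N.
  have perm : perm_eq (primes n) (r :: primes m).
    apply: uniq_perm => [||s]; first exact: primes_uniq.
      have nrm : ~~ (r %| m)%N by rewrite -prime_coprime.
      by rewrite /= primes_uniq andbT mem_primes (negbTE nrm) !andbF.
    by rewrite inE orbC {1}nE primesM ?expn_gt0 ?(prime_gt0 r_pr) // primesX // (primes_prime r_pr) mem_seq1.
  by rewrite /cnt (permP perm).
rewrite cntE {1}nE mulnC.
apply: (@leq_trans ((k.+1 * ndiv m) ^ j)).
  by rewrite leq_exp2r // ndiv_pfactor.
rewrite expnMn; apply: (@leq_trans ((c ^ (r < B) * r ^ k) * (c ^ cnt m * m))); last first.
  rewrite {1}nE expnD; apply: eq_leq; ring.
apply: leq_mul; last exact: IHn.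
have [rB|rB] := ltnP r B.
  apply: leq_trans (leq_expS_pow2 k j0) _.
  by rewrite leq_mul2l leq_exp2r ?r1 ?orbT.
rewrite mul1n; apply: (@leq_trans ((2 ^ k) ^ j)); first by rewrite leq_exp2r // ltn_expl.
by rewrite -expnM mulnC expnM leq_exp2r.
Qed.

Section RealBounds.
Variable R : realType.

(** The j-th root of [ndiv_exp_bound], for a j with 1 / j <= d. *)
Lemma ndiv_powR_bound (d : R) : 0 < d ->
  exists C : R, forall n, (0 < n)%N -> (ndiv n)%:R <= C * n%:R `^ d.
Proof.
move=> d0; pose j := (Num.truncn d^-1).+1.
have jR : (0 : R) < j%:R by rewrite ltr0n.
have hj : j%:R^-1 <= d.
  rewrite invf_ple ?posrE //; apply: ltW; apply: truncnS_gt.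
pose A := ((j ^ j) ^ (2 ^ j))%N.
exists (A%:R `^ j%:R^-1) => n n0.
have n1 : (1 : R) <= n%:R by rewrite ler1n.
apply: (@le_trans _ _ (A%:R `^ j%:R^-1 * n%:R `^ j%:R^-1)); last first.
  by rewrite ler_wpM2l ?powR_ge0 // ler_powR.
rewrite -powRM ?ler0n // -natrM.
have -> : (ndiv n)%:R = ((ndiv n)%:R ^+ j) `^ j%:R^-1 :> R.
  by rewrite -powR_mulrn ?ler0n // -powRrM divff ?gt_eqF // powRr1 ?ler0n.
apply: ge0_ler_powR; rewrite ?nnegrE ?invr_ge0 ?ler0n ?exprn_ge0 //.
by rewrite -natrX ler_nat ndiv_exp_bound.
Qed.

Lemma harm_le_ln n : (0 < n)%N -> harm R n.+1 <= 1 + ln n%:R.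
Proof.
case: n => // n _; elim: n => [|n IHn].
  by rewrite /harm big_nat1 invr1 ln1 addr0.
rewrite /harm big_nat_recr //= -/(harm R n.+2).
have n1 : (0 : R) < n.+1%:R by rewrite ltr0n.
have n2 : (0 : R) < n.+2%:R by rewrite ltr0n.
suff : n.+2%:R^-1 <= ln n.+2%:R - ln n.+1%:R :> R.
  by move=> h; apply: le_trans (lerD IHn h) _; rewrite addrACA subrr addrC; lra.
rewrite -ln_div ?posrE // -[leRHS]opprK -lnV ?posrE ?divr_gt0 // invf_div lerNr.
have -> : n.+1%:R / n.+2%:R = 1 + - n.+2%:R^-1 :> R by rewrite -[n.+2%:R]natr1; field; lra.
apply: le_ln1Dx; rewrite ltrN2 invf_lt1 // ltr1n //.
Qed.

(** H_n <= 1 + ln n, and ln n = ln(n^d) / d <= n^d / d. *)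
Lemma harm_powR_bound (d : R) : 0 < d ->
  exists C : R, forall n, (0 < n)%N -> harm R n.+1 <= C * n%:R `^ d.
Proof.
move=> d0; exists (1 + d^-1) => n n0.
have nR : (0 : R) < n%:R by rewrite ltr0n.
have n1 : (1 : R) <= n%:R by rewrite ler1n.
have p1 : 1 <= n%:R `^ d by rewrite -[leLHS](powRr0 n%:R) ler_powR // ltW.
have hl : ln n%:R <= d^-1 * n%:R `^ d.
  rewrite mulrC ler_pdivlMr // mulrC -ln_powR.
  have -> : n%:R `^ d = 1 + (n%:R `^ d - 1) by ring.
  by apply: le_trans (le_ln1Dx _) _; lra.
apply: le_trans (harm_le_ln n0) _; rewrite mulrDl mul1r; apply: lerD => //.
Qed.
End RealBounds.

(** * Saturated fractions *)

(* For q >= 2 the least a >= q with a x = 1 mod q is q plus the inverse of x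
   modulo q, so this says that the matrix (a q; c x) with smallest trace
   satisfies a + x <= Q. *)
Definition sat_pair (Q q x : nat) : bool :=
  if q is p.+2 then
    [&& (x < p.+2)%N, (x%:R : 'I_p.+2) \is a GRing.unit &
        (p.+2 + (x + ((x%:R : 'I_p.+2)^-1)%R) <= Q)%N]
  else [&& q == 1%N, x == 1%N & (3 <= Q)%N].

(** The determinant makes a an inverse of d modulo b, and a >= b; hence a is at least b plus the
    least positive inverse. *)
Lemma sat_pair_of_entries (Q a b c d : nat) :
  (0 < d)%N -> (d <= b <= a)%N -> (d <= c <= a)%N -> (a * d = b * c + 1)%N ->
  (a + d <= Q)%N -> sat_pair Q b d.
Proof.
move=> d0 /andP[db ba] /andP[dc ca] hdet htr.
case: b db ba hdet => [|[|p]] db ba hdet; first lia.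
  by rewrite /sat_pair; apply/and3P; split=> //; nia.
have dlt : (d < p.+2)%N.
  (* If d = b, the determinant equation makes b divide 1, impossible for b >= 2. *)
  rewrite ltn_neqAle db andbT; apply/eqP => dE; move: hdet; rewrite dE.
  move=> h; have : (p.+2 %| 1)%N by rewrite -(dvdn_addr 1 (dvdn_mulr c (dvdnn p.+2))) -h dvdn_mull.
  by rewrite dvdn1.
have had : (d%:R * a%:R : 'I_p.+2) = 1.
  rewrite -natrM mulnC hdet natrD natrM.
  have -> : (p.+2%:R : 'I_p.+2) = 0 by apply/val_inj; have := @val_Zp_nat p.+2 isT p.+2; rewrite modnn.
  by rewrite mul0r add0r.
have ud : (d%:R : 'I_p.+2) \is a GRing.unit by apply/unitrP; exists a%:R; rewrite mulrC had.
have invd : ((d%:R : 'I_p.+2)^-1)%R = a%:R by rewrite -[RHS](mulKr ud) had mulr1.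
rewrite /sat_pair dlt ud invd (@val_Zp_nat p.+2) //=.
have := divn_eq a p.+2; have : (0 < a %/ p.+2)%N by rewrite divn_gt0.
by move: (a %/ p.+2)%N (a %% p.+2)%N => u v u0 aE; nia.
Qed.

Lemma sat_pair_entries (Q q x : nat) : sat_pair Q q x ->
  exists a c, [/\ (0 < x)%N, (x <= q <= a)%N, (x <= c <= a)%N,
                  (a * x = q * c + 1)%N & (a + x <= Q)%N].
Proof.
case: q => [|[|p]] //=; first by case/andP => /eqP-> Q3; exists 2%N, 1%N.
case/and3P=> xq ux hQ; set v := ((x%:R : 'I_p.+2)^-1)%R in hQ.
have xv : (x%:R * v : 'I_p.+2) = 1 by rewrite divrr.
have hmod : ((x * v) %% p.+2 = 1)%N.
  have := congr1 (@nat_of_ord _) xv; rewrite /= (@val_Zp_nat p.+2) //= modnMml.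
  by [].
have hdiv := divn_eq (x * v) p.+2; rewrite hmod in hdiv.
have x0 : (0 < x)%N.
  by rewrite lt0n; apply/eqP => xE; move: hdiv; rewrite xE mul0n div0n.
have vq : (v < p.+2)%N by exact: ltn_ord.
(* As x v = q w + 1 with w the quotient, (q + v) x = q (x + w) + 1. *)
exists (p.+2 + v)%N, (x + (x * v) %/ p.+2)%N.
have h1 : ((x * v) %/ p.+2 <= v)%N.
  rewrite -[leqRHS](mulKn v (ltn0Sn p.+1)) leq_div2r // leq_mul2r ltnW ?orbT //.
by move: hdiv h1; move: ((x * v) %/ p.+2)%N => w hdiv h1; split; try lia; nia.
Qed.

Lemma det_mx22 (R : comPzRingType) (M : 'M[R]_2) :
  \det M = M 0 0 * M 1 1 - M 0 1 * M 1 0.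
Proof.
rewrite (expand_det_row _ ord0) !big_ord_recl big_ord0 /cofactor !det_mx11 !mxE /=.
rewrite addr0 expr0 mul1r /bump /= expr1 mulN1r mulrN.
by congr (_ * M _ _ - M _ _ * M _ _); apply/val_inj.
Qed.

Lemma satFareyP Q r : satFarey Q r <->
  exists q x, sat_pair Q q x /\ r = x%:R / q%:R :> rat.
Proof.
have lift1 : lift ord0 ord0 = 1 :> 'I_2 by apply/val_inj.
split.
- case=> M [[hdet /andP[h1 h2] /andP[h3 h4] h5] htr] <-.
  move: htr hdet; rewrite /mxtrace big_ord_recl big_ord1 lift1 det_mx22 => htr hdet.
  rewrite /Psi -[ord0]/(0 : 'I_2) in htr *.
  have nat_of z : 0 <= z -> exists n : nat, z = n%:Z.
    by move=> z0; exists `|z|%N; rewrite gez0_abs.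
  have d0 := le_trans ler01 h5.
  have [d dE] := nat_of _ d0; have [b bE] := nat_of _ (le_trans d0 h1).
  have [c cE] := nat_of _ (le_trans d0 h3).
  have [a aE] := nat_of _ (le_trans (le_trans d0 h1) h2).
  rewrite aE bE cE dE in h1 h2 h3 h4 h5 htr hdet *.
  exists b, d; split; last by [].
  by apply: (@sat_pair_of_entries Q a _ c); lia.
- case=> q [x [/sat_pair_entries[a [c [x0 /andP[xq qa] /andP[xc ca] hdet htr]]] ->]].
  exists (\matrix_(i < 2, j < 2) if i == 0 then if j == 0 then a%:Z else q%:Z
     else if j == 0 then c%:Z else x%:Z); last by rewrite /Psi !mxE /=.
  split; last by rewrite /mxtrace big_ord_recl big_ord1 !mxE /= -PoszD lez_nat.
  by split; rewrite ?det_mx22 !mxE /=; lia.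
Qed.

Lemma sat_pair_bounds Q q x : sat_pair Q q x ->
  [/\ (0 < x <= q)%N, (0 < q <= Q)%N & coprime q x].
Proof.
case/sat_pair_entries => a [c [x0 /andP[xq qa] /andP[xc ca] hdet htr]].
split; rewrite ?x0 ?(leq_trans x0 xq) //; first by lia.
have : (gcdn q x %| 1)%N.
  rewrite -(dvdn_addr 1 (dvdn_mulr c (dvdn_gcdl q x))) -hdet.
  by rewrite dvdn_mull // dvdn_gcdr.
by rewrite dvdn1.
Qed.

Lemma natr_div_inj (q x q' x' : nat) : (0 < q)%N -> (0 < q')%N ->
  coprime q x -> coprime q' x' -> x%:R / q%:R = x'%:R / q'%:R :> rat ->
  (q, x) = (q', x').
Proof.
move=> q0 q0' cqx cqx' h.
have := coprimeq_num (n := x) (d := q); have := coprimeq_num (n := x') (d := q').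
have := coprimeq_den (n := x) (d := q); have := coprimeq_den (n := x') (d := q').
rewrite !absz_nat ![coprime _ q]coprime_sym ![coprime _ q']coprime_sym.
move=> /(_ cqx') d' /(_ cqx) d /(_ cqx') n' /(_ cqx) n.
have q0Z : 0 < q%:Z by rewrite ltz_nat.
have q0Z' : 0 < q'%:Z by rewrite ltz_nat.
move: d n; rewrite -!pmulrn h d' n' !gtr0_sg // !gt_eqF // !gtr0_norm // !mul1r.
by move=> [->] [->].
Qed.

(** The pairs are in lowest terms, so distinct pairs give distinct fractions and the set is counted
    without multiplicity by pairs. *)
Lemma satFarey_countE (R : realType) (Q : nat) (b : R) :
  satFarey_count Q b =
  (\sum_(1 <= q < Q.+1) \sum_(1 <= x < Q.+1 | (x%:R <= b * q%:R)%R) sat_pair Q q x)%N.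
Proof.
pose L := [seq (q, x) | q <- index_iota 1 Q.+1, x <- index_iota 1 Q.+1].
pose P (t : nat * nat) := (t.2%:R <= b * t.1%:R) && sat_pair Q t.1 t.2.
pose f (t : nat * nat) : rat := t.2%:R / t.1%:R.
have uL : uniq L.
  by apply: allpairs_uniq; rewrite ?iota_uniq // => -[? ?] [? ?] _ _ [-> ->].
have fin : finite_set (satFarey Q `&` [set r : rat | 0 <= (ratr r : R) <= b])%classic.
  exact/finite_setIl/finite_satFarey.
have ratr_f q x : ratr (x%:R / q%:R : rat) = x%:R / q%:R :> R.
  by rewrite fmorph_div /= !ratr_nat.
have perm : perm_eq (fset_set (satFarey Q `&` [set r : rat | 0 <= (ratr r : R) <= b])%classic)
    [seq f t | t <- L & P t].
  apply: uniq_perm; first exact: fset_uniq.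
    rewrite map_inj_in_uniq ?filter_uniq //.
    move=> [q x] [q' x']; rewrite !mem_filter => /andP[/andP[/= _ h] _] /andP[/andP[/= _ h'] _].
    have [_ /andP[q0 _] cqx] := sat_pair_bounds h.
    have [_ /andP[q0' _] cqx'] := sat_pair_bounds h'.
    exact: natr_div_inj.
  move=> r; rewrite in_fset_set //; apply/idP/mapP.
    rewrite inE => -[/satFareyP[q [x [hqx ->]]] /=]; rewrite ratr_f => /andP[_ hb].
    have [/andP[x0 xq] /andP[q0 qQ] _] := sat_pair_bounds hqx.
    have qR : (0 : R) < q%:R by rewrite ltr0n.
    exists (q, x); rewrite // mem_filter /P /= hqx -ler_pdivrMr // hb /=.
    apply/allpairsP; exists (q, x); split => //=.
      by rewrite mem_index_iota q0.
    by rewrite mem_index_iota x0 ltnS (leq_trans xq).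
  case=> -[q x]; rewrite mem_filter => /andP[/andP[/= hb hqx] _] ->.
  have [/andP[x0 xq] /andP[q0 qQ] _] := sat_pair_bounds hqx.
  have qR : (0 : R) < q%:R by rewrite ltr0n.
  rewrite inE; split; first by apply/satFareyP; exists q, x.
  by rewrite /f /= ratr_f ler_pdivrMr // hb divr_ge0.
rewrite /satFarey_count (perm_size perm) size_map -sum1_size big_filter big_mkcond.
rewrite big_allpairs; apply: eq_bigr => q _; rewrite [RHS]big_mkcond.
by apply: eq_bigr => x _; rewrite /P /=; case: ifP => /=; case: (x%:R <= _) => //= ->.
Qed.

Lemma big_nat1_ord (V : nmodType) (F : nat -> V) (q N : nat) : (q <= N.+1)%N ->
  F 0%N = 0 -> (forall x, (q <= x)%N -> F x = 0) ->
  \sum_(1 <= x < N.+1) F x = \sum_(x < q) F x.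
Proof.
move=> qN F0 Fq; rewrite -[LHS]add0r -{1}F0 -big_ltn //.
rewrite (@big_cat_nat _ _ _ q) //= [X in _ + X]big_nat [X in _ + X]big1; last first.
  by move=> x /andP[qx _]; exact: Fq.
by rewrite addr0 big_mkord.
Qed.

Lemma big_nat_le1 (V : nmodType) (F : nat -> V) (P : pred nat) (N : nat) : (0 < N)%N ->
  (forall x, P x -> (x <= 1)%N) ->
  \sum_(1 <= x < N.+1 | P x) F x = if P 1%N then F 1%N else 0.
Proof.
move=> N0 P1; rewrite big_ltn_cond // big_nat_cond big_pred0 ?addr0 // => x.
by apply/negP => /andP[/andP[x1 _] /P1]; rewrite leqNgt x1.
Qed.

(** * Main term and error for one modulus *)

Section ModulusTerm.
Variables (R : realType) (p Q : nat) (b : R).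
Local Notation q := p.+2.
Hypotheses (b0 : 0 <= b) (qQ : (q <= Q)%N).
Local Notation X := (Num.truncn (b * q%:R)).

Lemma le_truncn_mul x : (x <= X)%N = (x%:R <= b * q%:R).
Proof. by rewrite truncn_ge_nat // mulr_ge0. Qed.

Lemma sum_sat_pair :
  (\sum_(1 <= x < Q.+1 | (x%:R <= b * q%:R)%R) sat_pair Q q x)%N = inv_count p X (Q - q).
Proof.
rewrite big_mkcond (@big_nat1_ord nat _ q) ?(leq_trans qQ) //; first last.
- move=> x qx; case: ifP => // _; rewrite /sat_pair; case: ltnP => //.
  by rewrite ltnNge qx.
- by case: ifP => // _; rewrite /sat_pair unitr0 andbF.
rewrite /inv_count -sum1_card [RHS]big_mkcond; apply: eq_bigr => x _.
rewrite inE le_truncn_mul /sat_pair natr_Zp ltn_ord /=.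
by rewrite leq_subRL //; case: (x%:R <= _); rewrite ?andbF //= andbA ?andbT.
Qed.

(** Truncated subtraction on the right plays the part of the cut at 0, and [minn q] that of the cut
    at 1. *)
Lemma clamp_minn x :
  clamp (R := R) (Q%:R / q%:R - 1 - x%:R / q%:R) = (minn q (Q - q - x))%:R / q%:R.
Proof.
have q0 : (0 : R) < q%:R by rewrite ltr0n.
have -> : Q%:R / q%:R - 1 - x%:R / q%:R = ((Q - q)%:R - x%:R) / q%:R :> R.
  by rewrite natrB //; field; lra.
rewrite /clamp pmulr_lle0 ?invr_gt0 // subr_le0 ler_nat ler_pdivrMr // mul1r.
case: leqP => h1; first by rewrite (eqP h1) minn0 mul0r.
rewrite -natrB ?ler_nat; last exact: ltnW.
by case: leqP => h2 //; rewrite divff // gt_eqF.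
Qed.

Hypothesis b1 : b <= 1.

Lemma sum_clamp_modulus :
  \sum_(1 <= x < Q.+1 | (x%:R <= b * q%:R) && coprime q x)
     clamp (R := R) (Q%:R / q%:R - 1 - x%:R / q%:R) =
  (\sum_(x : 'I_q | (x \is a GRing.unit) && (x <= X)%N) minn q (Q - q - x))%:R / q%:R.
Proof.
rewrite big_mkcond (@big_nat1_ord R _ q) ?(leq_trans qQ) //; first last.
- move=> x qx; case: ifP => // /andP[xb].
  have xq : (x <= q)%N.
    by rewrite -(ler_nat R) (le_trans xb) // ler_piMl.
  (* Only x = q is left beyond the ordinals, and it is not coprime to q >= 2. *)
  have -> : x = q by apply/eqP; rewrite eqn_leq xq.
  by rewrite /coprime gcdnn.
- by rewrite /coprime gcdn0 andbF.
rewrite natr_sum mulr_suml [RHS]big_mkcond; apply: eq_bigr => x _.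
rewrite clamp_minn le_truncn_mul andbC.
by rewrite -[x in RHS]natr_Zp (@unitZpE q) // natr_Zp.
Qed.
End ModulusTerm.

Lemma sum_sat_pair_asymp (R : realType) (p Q : nat) (b : R) :
  0 <= b <= 1 -> (p.+2 <= Q)%N ->
  `|(\sum_(1 <= x < Q.+1 | (x%:R <= b * p.+2%:R)%R) sat_pair Q p.+2 x)%:R -
    \sum_(1 <= x < Q.+1 | (x%:R <= b * p.+2%:R) && coprime p.+2 x)
       clamp (R := R) (Q%:R / p.+2%:R - 1 - x%:R / p.+2%:R)|
  <= 4 * kloo_const R p * (ndiv p.+2)%:R * harm R p.+2 * (1 + 4 * harm R p.+2).
Proof.
case/andP=> b0 b1 qQ; rewrite (sum_sat_pair b0 qQ) (sum_clamp_modulus b0 qQ b1).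
exact: inv_count_real.
Qed.

(** The modulus 1 is treated apart from the rings ['I_p.+2]: only x = 1 can occur, and both terms
    lie in [0, 1]. *)
Lemma sum_sat_pair1 (R : realType) (Q : nat) (b : R) : (0 < Q)%N -> 0 <= b <= 1 ->
  `|(\sum_(1 <= x < Q.+1 | (x%:R <= b * 1%:R)%R) sat_pair Q 1 x)%:R -
    \sum_(1 <= x < Q.+1 | (x%:R <= b * 1%:R) && coprime 1 x)
       clamp (R := R) (Q%:R / 1%:R - 1 - x%:R / 1%:R)| <= 1.
Proof.
move=> Q0 /andP[b0 b1].
have big1x x : x%:R <= b * 1%:R -> (x <= 1)%N.
  by rewrite mulr1 => xb; rewrite -(ler_nat R) (le_trans xb).
rewrite (@big_nat_le1 nat) // (@big_nat_le1 R) //; last by move=> x /andP[/big1x].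
have c0 := clamp_ge0 (Q%:R / 1%:R - 1 - 1%:R / 1%:R : R).
have c1 := clamp_le1 (Q%:R / 1%:R - 1 - 1%:R / 1%:R : R).
have s1 : (sat_pair Q 1 1)%:R = 0 :> R \/ (sat_pair Q 1 1)%:R = 1 :> R.
  by case: sat_pair; [right|left].
rewrite coprime1n andbT; case: ifP => h; rewrite ?h /= ?addn0 ?addr0 ?subrr ?normr0 ?ler01 //.
by rewrite ler_norml; apply/andP; case: s1 => ->; split; lra.
Qed.

Lemma kloo_const_le (R : realType) (p : nat) :
  kloo_const R p <= 2 * p.+2%:R `^ (3 / 4) * (ndiv p.+2)%:R.
Proof.
have d1 : (1 <= ndiv p.+2)%N by rewrite /ndiv lt0n size_eq0; case: (divisors _) (divisor1 p.+2).
have k0 : 0 <= kloo_const R p by exact: sqrtr_ge0.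
rewrite -(@ler_pXn2r _ 4) ?nnegrE ?mulr_ge0 ?powR_ge0 ?ler0n //.
have -> : kloo_const R p ^+ 4 = (2 * p.+2 ^ 3 * ndiv p.+2 ^ 3)%:R.
  by rewrite /kloo_const (exprM _ 2 2) !sqr_sqrtr ?sqrtr_ge0 // ler0n.
rewrite !exprMn -[(_ `^ _) ^+ 4]powR_mulrn ?powR_ge0 // -powRrM.
have -> : 3 / 4 * 4 = 3 :> R by field.
rewrite powR_mulrn ?ler0n // -!natrX -!natrM ler_nat.
have : (ndiv p.+2 ^ 3 <= ndiv p.+2 ^ 4)%N by rewrite leq_pexp2l.
by nia.
Qed.

(** The errors of the moduli q <= Q are added, each bounded by its value with Q in place of q. The
    fourth power of Q^d comes from two divisor factors, one in [kloo_const] and one from the gcd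
    sum, and two harmonic ones; 40 is 4 * 2 * 5. *)
Lemma satFarey_count_sum_clamp (R : realType) (b d C1 C2 : R) (Q : nat) :
  0 <= b <= 1 -> (0 < Q)%N -> 0 <= d ->
  (forall n, (0 < n)%N -> (ndiv n)%:R <= C1 * n%:R `^ d) ->
  (forall n, (0 < n)%N -> harm R n.+1 <= C2 * n%:R `^ d) ->
  `|(satFarey_count Q b)%:R -
    \sum_(1 <= q < Q.+1) \sum_(1 <= x < Q.+1 | (x%:R <= b * q%:R) && coprime q x)
      clamp (R := R) (Q%:R / q%:R - 1 - x%:R / q%:R)|
  <= 1 + Q%:R * (40 * C1 ^+ 2 * C2 ^+ 2 * Q%:R `^ (3 / 4) * (Q%:R `^ d) ^+ 4).
Proof.
move=> b01 Q0 d0 hC1 hC2; rewrite satFarey_countE natr_sum -sumrB.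
rewrite big_ltn //; apply: le_trans (ler_normD _ _) _.
apply: lerD; first exact: sum_sat_pair1.
apply: le_trans (ler_norm_sum _ _ _) _.
set K := 40 * _ * _ * _ * _.
have C1_ge0 : 0 <= C1.
  by have := le_trans (ler0n R _) (hC1 1%N isT); rewrite powR1 mulr1.
have C2_ge1 : 1 <= C2.
  by have := hC2 1%N isT; rewrite powR1 mulr1 /harm big_nat1 invr1.
have C2_ge0 : 0 <= C2 by apply: le_trans C2_ge1.
have K0 : 0 <= K by rewrite /K !mulr_ge0 ?exprn_ge0 ?powR_ge0.
apply: (@le_trans _ _ (\sum_(2 <= q < Q.+1) K)); last first.
  by rewrite sumr_const_nat -[leLHS]mulr_natl ler_wpM2r // ler_nat; lia.
rewrite [leLHS]big_nat [leRHS]big_nat; apply: ler_sum => q /andP[].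
case: q => [|[|p]] // _; rewrite ltnS => qQ.
apply: le_trans (sum_sat_pair_asymp b01 qQ) _.
have qR : (p.+2%:R : R) <= Q%:R by rewrite ler_nat.
have powle e : 0 <= e -> p.+2%:R `^ e <= Q%:R `^ e :> R.
  by move=> e0; apply: ge0_ler_powR; rewrite ?nnegrE ?ler0n.
set A := Q%:R `^ (3 / 4) in K K0 *; set D := Q%:R `^ d in K K0 *.
have nd : (ndiv p.+2)%:R <= C1 * D.
  by apply: le_trans (hC1 _ _) _ => //; rewrite ler_wpM2l ?powle.
have H1 : 1 <= harm R p.+2.
  rewrite /harm big_ltn // invr1 lerDl sumr_ge0 // => i _; rewrite invr_ge0 ler0n //.
have HD : harm R p.+2 <= C2 * D.
  apply: (@le_trans _ _ (harm R p.+3)).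
    by rewrite {2}/harm big_nat_recr //= lerDl invr_ge0 ler0n.
  apply: le_trans (hC2 _ _) _ => //; by rewrite ler_wpM2l // powle.
have kA : kloo_const R p <= 2 * A * (C1 * D).
  apply: le_trans (kloo_const_le _ _) _.
  apply: ler_pM; rewrite ?mulr_ge0 ?powR_ge0 ?ler0n //.
  by rewrite ler_wpM2l // powle // divr_ge0.
have k0 : 0 <= kloo_const R p by exact: sqrtr_ge0.
(* H >= 1 gives H (1 + 4 H) <= 5 H^2. *)
have HH : harm R p.+2 * (1 + 4 * harm R p.+2) <= 5 * (C2 * D) ^+ 2 by nra.
have -> : K = 4 * (2 * A * (C1 * D)) * (C1 * D) * (5 * (C2 * D) ^+ 2).
  by rewrite /K; ring.
rewrite -[leLHS]mulrA; apply: ler_pM => //.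
- by rewrite !mulr_ge0.
- by rewrite mulr_ge0 //; lra.
apply: ler_pM => //; first by rewrite mulr_ge0.
by rewrite ler_wpM2l.
Qed.

Theorem theorem1 (R : realType) (eps : R) (eps_gt0 : 0 < eps) :
  exists C : R, forall (beta : R) (Q : nat),
    0 <= beta <= 1 -> (0 < Q)%N ->
    `| (satFarey_count Q beta)%:R
       - Q%:R ^+ 2 / (2 * zeta (2 : R)) * ln (2 * (1 + beta) / (2 + beta)) |
    <= C * Q%:R `^ (7 / 4 + eps).
Proof.
(* The divisor and harmonic bounds enter the error with total power 4, so each is given exponent eps
   / 4. *)
have d0 : 0 < eps / 4 by lra.
have [C1 hC1] := ndiv_powR_bound d0; have [C2 hC2] := harm_powR_bound d0.
exists (1 + 40 * C1 ^+ 2 * C2 ^+ 2 + 9 * C2) => beta Q beta01 Q0.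
have h1 := satFarey_count_sum_clamp beta01 Q0 (ltW d0) hC1 hC2.
have h2 := sum_clamp_coprime_asymp Q0 beta01.
set S := \sum_(1 <= q < _) _ in h1 h2.
have Q1 : (1 : R) <= Q%:R by rewrite ler1n.
have C2_ge1 : 1 <= C2.
  by have := hC2 1%N isT; rewrite powR1 mulr1 /harm big_nat1 invr1.
have pow1 e : 0 <= e -> 1 <= Q%:R `^ e :> R.
  by move=> e0; rewrite -[leLHS](powRr0 Q%:R) ler_powR.
set A := Q%:R `^ (3 / 4) in h1; set D := Q%:R `^ (eps / 4) in h1.
have A1 : 1 <= A by apply: pow1; lra.
have D1 : 1 <= D by apply: pow1; lra.
have powE : Q%:R `^ (7 / 4 + eps) = Q%:R * (A * D ^+ 4).
  have Qn0 : Q%:R != 0 :> R by rewrite pnatr_eq0 -lt0n.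
  have -> : D ^+ 4 = Q%:R `^ eps.
    by rewrite -powR_mulrn ?powR_ge0 // -powRrM; congr (_ `^ _); field.
  have -> : 7 / 4 + eps = 1 + (3 / 4 + eps) by lra.
  by rewrite !powRD ?Qn0 ?implybT // powRr1 ?ler0n.
have HQ := hC2 Q Q0; rewrite -/D in HQ.
have D4 : D <= A * D ^+ 4.
  rewrite exprS mulrCA ler_peMr ?(le_trans ler01) //.
  by rewrite mulr_ege1 // exprn_ege1.
have AD1 : 1 <= A * D ^+ 4 by apply: le_trans D4.
rewrite powE -(subrKA S); apply: le_trans (ler_normD _ _) _.
rewrite addrC; apply: le_trans (lerD h2 h1) _.
have t1 : 9 * Q%:R * harm R Q.+1 <= 9 * C2 * (Q%:R * (A * D ^+ 4)).
  apply: (@le_trans _ _ (9 * Q%:R * (C2 * D))).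
    by rewrite ler_wpM2l // mulr_ge0.
  have -> : 9 * Q%:R * (C2 * D) = 9 * C2 * (Q%:R * D) by ring.
  by rewrite ler_wpM2l ?mulr_ge0 ?(le_trans ler01 C2_ge1) // ler_wpM2l.
have t2 : 1 <= Q%:R * (A * D ^+ 4) by rewrite mulr_ege1.
have -> : Q%:R * (40 * C1 ^+ 2 * C2 ^+ 2 * A * D ^+ 4)
  = 40 * C1 ^+ 2 * C2 ^+ 2 * (Q%:R * (A * D ^+ 4)) by ring.
by rewrite !mulrDl mul1r; lra.
Qed.
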